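(* Let $f_0(x,v)$ be an initial density such that $\hat f_0(\xi,v)$ has compact support in $\xi\in(-\sqrt{\pi},\sqrt{\pi})$ and such that $F_0(\xi,v)=\phi(v)\left(\hat f_0(\xi,v)-\frac{C_0(\xi)}{1+\Lambda(\xi)+\xi v i}\right)$ is Hölder continuous in $v$ on $\mathbb{R}$, with $C_0$ as defined in the context. Then the general solution $\hat f(t,\xi,v)$, given by $$\hat f(t,\xi,v)=e^{\Lambda(\xi)t}\frac{C_0(\xi)}{1+\Lambda(\xi)+\xi v i}+e^{-t}\left[-\mathrm{p.v.}\int_{\mathbb{R}}\frac{e^{-i\xi w t}K_0(\xi,w)}{i(w-v)}\,dw+\frac{e^{-i\xi v t}}{\phi(v)}\left(\xi-\mathrm{p.v.}\int_{\mathbb{R}}\frac{\phi(w)}{i(w-v)}\,dw\right)K_0(\xi,v)\right],$$ satisfies $$\hat f(t,\xi,v)\sim e^{\Lambda(\xi)t}\frac{C_0(\xi)}{1+\Lambda(\xi)+\xi v i}\qquad\text{as } t\to\infty,$$ in the sense that for each fixed $(\xi,v)$ with $|\xi|<\sqrt{\pi}$ and $C_0(\xi)\ne0$ the quotient of the two sides tends to $1$. The right-hand side has the form $e^{\Lambda(\xi)t}\frac{\hat\rho_0(\xi)}{1+\Lambda(\xi)+\xi v i}$ (with $\hat\rho_0=C_0$) of the Fourier transform of a grossly determined solution.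
   Context: The equation is $$\frac{\partial f}{\partial t}(t,x,v)+v\frac{\partial f}{\partial x}(t,x,v)=-f(t,x,v)+\int_{-\infty}^{\infty}\phi(w)f(t,x,w)\,dw,\qquad f(0,x,v)=f_0(x,v),$$ with $\phi(v)=e^{-v^2}/\sqrt{\pi}$ and $x,v\in\mathbb{R}$. The hat denotes the Fourier transform in $x$, with $\partial_x$ becoming multiplication by $i\xi$. ''p.v.'' denotes the Cauchy principal value; all integrals with kernel $1/(\tau-v)$, $v\in\mathbb{R}$, are principal values. Notation: $A_\xi(v)=\xi-2iD(v)$, $B(v)=-\pi\phi(v)$, $D(y)=e^{-y^2}\int_0^y e^{x^2}\,dx$ (Dawson's function). Let $\Xi:\mathbb{R}\setminus\{0\}\to(-\sqrt{\pi},0)\cup(0,\sqrt{\pi})$ be the odd invertible function $\Xi(\eta)=\int_{\mathbb{R}}\frac{\eta\,\phi(v)}{\eta^2+v^2}\,dv$, $\eta(\xi)=\Xi^{-1}(\xi)$, and $\Lambda(\xi)=-1+\xi\,\eta(\xi)$ for $0<|\xi|<\sqrt{\pi}$, extended continuously by $\Lambda(0)=0$. Define $$\Gamma^+(v)=\frac12\ln\left[\left(\frac{v-i}{v+i}\right)^{-\chi}\frac{A_\xi(v)-B(v)}{A_\xi(v)+B(v)}\right]+\frac{1}{2\pi i}\int_{\mathbb{R}}\ln\left[\left(\frac{\tau-i}{\tau+i}\right)^{-\chi}\frac{A_\xi(\tau)-B(\tau)}{A_\xi(\tau)+B(\tau)}\right]\frac{d\tau}{\tau-v},$$ where $\chi$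 is the winding number of $v\mapsto\frac{A_\xi(v)-B(v)}{A_\xi(v)+B(v)}$ along $\mathbb{R}$ ($\chi=-1$ for $|\xi|<\sqrt{\pi}$, $\chi=0$ for $|\xi|>\sqrt{\pi}$), and the logarithm is the continuous branch along $\mathbb{R}$ tending to $0$ at $\pm\infty$. For $|\xi|<\sqrt{\pi}$, $$C_0(\xi)=\frac{\displaystyle\int_{\mathbb{R}}\frac{\phi(\tau)\hat f_0(\xi,\tau)}{e^{\Gamma^+(\tau)}[A_\xi(\tau)+B(\tau)][1+\Lambda(\xi)+\xi\tau i]}\frac{d\tau}{\tau+i}}{\displaystyle\int_{\mathbb{R}}\frac{\phi(\tau)}{e^{\Gamma^+(\tau)}[A_\xi(\tau)+B(\tau)][1+\Lambda(\xi)+\xi\tau i]}\frac{d\tau}{\tau+i}},$$ and $C_0(\xi)\equiv0$ for $|\xi|\ge\sqrt{\pi}$ (terms containing it are then read as $0$). Further $$K_0(\xi,v)=\frac{A_\xi(v)}{A_\xi^2(v)-B^2(v)}F_0(\xi,v)-\frac{e^{\Gamma^+(v)}B(v)}{A_\xi(v)-B(v)}\,\frac{1}{\pi i}\int_{\mathbb{R}}\frac{F_0(\xi,\tau)}{e^{\Gamma^+(\tau)}(A_\xi(\tau)+B(\tau))}\frac{d\tau}{\tau-v}.$$ A grossly determined solution is one determined at each instant by the gross fields of the gas at that time (here the density $\rho(t,x)=\int_{\mathbb{R}}\phi(v)f(t,x,v)\,dv$). The known class of grossly determined solutions of this equation consists, under Fourier transform, of the functions $e^{\Lambda(\xi)t}\frac{\hat\rho_0(\xi)}{1+\Lambda(\xi)+\xi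 v i}$, where $\hat\rho_0$ is the Fourier transform of the initial density. *)

(* Defs.v *)
From mathcomp Require Import all_boot all_order all_algebra.
From mathcomp Require Import all_classical all_reals all_analysis.
From mathcomp Require Import complex.

Set Implicit Arguments.
Unset Strict Implicit.
Unset Printing Implicit Defensive.

Import Order.TTheory GRing.Theory Num.Theory numFieldNormedType.Exports.

Local Open Scope classical_set_scope.
Local Open Scope ring_scope.
Local Open Scope complex_scope.

(* R[i] carries no topology in the library, so limits, continuity and         *)
(* integrals of complex-valued functions are taken on real and imaginary      *)
(* parts.                                                                     *)

Definition ccvg (R : realType) (F : set_system R) (f : R -> R[i]) (l : R[i]) :=
  (complex.Re (f x) @[x --> F] --> complex.Re l) /\
  (complex.Im (f x) @[x --> F] --> complex.Im l).

Definition clim (R : realType) (F : set_system R) (f : R -> R[i]) : R[i] :=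
  lim (complex.Re (f x) @[x --> F]) +i* lim (complex.Im (f x) @[x --> F]).

Definition ccontinuous (R : realType) (f : R -> R[i]) :=
  forall x, ccvg (nbhs x) f (f x).

Definition cexp (R : realType) (z : R[i]) : R[i] :=
  (expR (complex.Re z) * cos (complex.Im z)) +i*
  (expR (complex.Re z) * sin (complex.Im z)).

Definition cintegrable (R : realType) (A : set R) (f : R -> R[i]) :=
  (@lebesgue_measure R).-integrable A (EFin \o (fun x => complex.Re (f x))) /\
  (@lebesgue_measure R).-integrable A (EFin \o (fun x => complex.Im (f x))).

Definition cintegral (R : realType) (A : set R) (f : R -> R[i]) : R[i] :=
  (\int[@lebesgue_measure R]_(x in A) complex.Re (f x)) +i*
  (\int[@lebesgue_measure R]_(x in A) complex.Im (f x)).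

(* Cauchy principal value at v of the integral over the real line of f, where *)
(* f includes the singular kernel; only the singularity at v is cut out       *)
(* symmetrically, infinity is handled by Lebesgue integration.                *)
Definition pv_integral (R : realType) (v : R) (f : R -> R[i]) : R[i] :=
  clim (0 : R)^'+ (fun e => cintegral [set w | e < `|w - v|] f).

Definition holder_continuous (R : realType) (f : R -> R[i]) :=
  exists C alpha : R, [/\ 0 < alpha, alpha <= 1 &
    forall x y, Normc.normc (f x - f y) <= C * (`|x - y| `^ alpha)].

(* Fourier transform in x; d/dx becomes multiplication by i xi. All the       *)
(* functions below are linear in the transformed datum, so the choice of the  *)
(* normalizing constant is immaterial.                                        *)
Definition fourier_x (R : realType) (f : R -> R -> R) (xi v : R) : R[i] :=
  cintegral setT (fun x => cexp (- 'i%C * (xi * x)%:C) * (f x v)%:C).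

(* Winding number along the real line of a curve g : R -> C \ {0} having the  *)
(* same limit at both ends: the total increment of a continuous logarithm,    *)
(* divided by 2 pi i.                                                         *)
Definition winding_number (R : realType) (g : R -> R[i]) : int :=
  xget 0 [set n : int | exists (th : R -> R[i]) (a b : R[i]),
    [/\ ccontinuous th, forall v, cexp (th v) = g v,
        ccvg -oo th a, ccvg +oo th b & b - a = 2 * pi%:C * 'i%C * n%:~R]].

(* The continuous logarithm of g along the real line vanishing at both ends.  *)
Definition log_branch (R : realType) (g : R -> R[i]) : R -> R[i] :=
  xget (fun=> 0) [set L : R -> R[i] |
    [/\ ccontinuous L, forall v, cexp (L v) = g v,
        ccvg -oo L 0 & ccvg +oo L 0]].

Definition phi (R : realType) (v : R) : R :=
  expR (- v ^+ 2) / Num.sqrt pi.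

Definition dawson (R : realType) (y : R) : R :=
  expR (- y ^+ 2) *
  (if 0 <= y then \int[@lebesgue_measure R]_(x in `[0, y]) expR (x ^+ 2)
   else - \int[@lebesgue_measure R]_(x in `[y, 0]) expR (x ^+ 2)).

Definition A_ (R : realType) (xi v : R) : R[i] :=
  xi%:C - 2 * 'i%C * (dawson v)%:C.

Definition B_ (R : realType) (v : R) : R[i] := (- (pi * phi v))%:C.

Definition Xi (R : realType) (eta : R) : R :=
  \int[@lebesgue_measure R]_(v in setT) (eta * phi v / (eta ^+ 2 + v ^+ 2)).

(* Inverse of Xi as a function on R \ {0}; meaningful for 0 < |xi| < sqrt pi. *)
Definition eta (R : realType) (xi : R) : R :=
  'pinv_(fun=> 0) [set e : R | e != 0] (@Xi R) xi.

Definition Lambda (R : realType) (xi : R) : R :=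
  if xi == 0 then 0 else - 1 + xi * eta xi.

Definition gd_den (R : realType) (xi v : R) : R[i] :=
  1 + (Lambda xi)%:C + (xi * v)%:C * 'i%C.

Definition symbol_ratio (R : realType) (xi v : R) : R[i] :=
  (A_ xi v - B_ v) / (A_ xi v + B_ v).

Definition chi (R : realType) (xi : R) : int := winding_number (symbol_ratio xi).

Definition log_symbol (R : realType) (xi : R) : R -> R[i] :=
  log_branch (fun v =>
    ((v%:C - 'i%C) / (v%:C + 'i%C)) ^ (- chi xi) * symbol_ratio xi v).

Definition Gamma_plus (R : realType) (xi v : R) : R[i] :=
  2^-1 * log_symbol xi v +
  (2 * pi%:C * 'i%C)^-1 *
    pv_integral v (fun tau => log_symbol xi tau / (tau - v)%:C).

(* In C0, F0, K0, gd_part and fhat, g xi v is the transform of the datum f0.  *)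

Definition C0 (R : realType) (g : R -> R -> R[i]) (xi : R) : R[i] :=
  if `|xi| < Num.sqrt pi then
    cintegral setT (fun tau =>
      (phi tau)%:C * g xi tau /
      (cexp (Gamma_plus xi tau) * (A_ xi tau + B_ tau) * gd_den xi tau) /
      (tau%:C + 'i%C)) /
    cintegral setT (fun tau =>
      (phi tau)%:C /
      (cexp (Gamma_plus xi tau) * (A_ xi tau + B_ tau) * gd_den xi tau) /
      (tau%:C + 'i%C))
  else 0.

Definition F0 (R : realType) (g : R -> R -> R[i]) (xi v : R) : R[i] :=
  (phi v)%:C * (g xi v - C0 g xi / gd_den xi v).

Definition K0 (R : realType) (g : R -> R -> R[i]) (xi v : R) : R[i] :=
  A_ xi v / (A_ xi v ^+ 2 - B_ v ^+ 2) * F0 g xi v -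
  cexp (Gamma_plus xi v) * B_ v / (A_ xi v - B_ v) *
  ((pi%:C * 'i%C)^-1 *
    pv_integral v (fun tau =>
      F0 g xi tau / (cexp (Gamma_plus xi tau) * (A_ xi tau + B_ tau)) /
      (tau - v)%:C)).

(* For |xi| >= sqrt pi this is 0, because C0 is.                              *)
Definition gd_part (R : realType) (g : R -> R -> R[i]) (t xi v : R) : R[i] :=
  (expR (Lambda xi * t))%:C * (C0 g xi / gd_den xi v).

Definition fhat (R : realType) (g : R -> R -> R[i]) (t xi v : R) : R[i] :=
  gd_part g t xi v +
  (expR (- t))%:C *
  (- pv_integral v (fun w =>
       cexp (- 'i%C * (xi * w * t)%:C) * K0 g xi w / ('i%C * (w - v)%:C)) +
   cexp (- 'i%C * (xi * v * t)%:C) / (phi v)%:C *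
   (xi%:C - pv_integral v (fun w => (phi w)%:C / ('i%C * (w - v)%:C))) *
   K0 g xi v).

(* h is, under Fourier transform, a grossly determined solution, and rho0 the *)
(* transform of its density at time 0; both are considered on the band        *)
(* |xi| < sqrt pi, where Lambda is defined.                                   *)
Definition grossly_determined_hat (R : realType)
    (h : R -> R -> R -> R[i]) (rho0 : R -> R[i]) :=
  forall xi, `|xi| < Num.sqrt pi ->
    cintegral setT (fun v => (phi v)%:C * h 0 xi v) = rho0 xi /\
    forall t v, h t xi v =
      (expR (Lambda xi * t))%:C * (rho0 xi / gd_den xi v).

(* Main.v *)
Require Import Defs.
From mathcomp Require Import all_boot all_order all_algebra.
From mathcomp Require Import all_classical all_reals all_analysis.
From mathcomp Require Import complex.
From mathcomp Require Import ring lra measurable_realfun.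

Set Implicit Arguments.
Unset Strict Implicit.

Import Order.TTheory GRing.Theory Num.Theory numFieldNormedType.Exports.
Import Normc.

Local Open Scope classical_set_scope.
Local Open Scope ring_scope.
Local Open Scope complex_scope.

(** Dividing by the gross part, the claim is that the transient is
    o(exp ((1 + Lambda) t)), and 1 + Lambda = xi eta(xi) > 0 for xi <> 0.  The
    transient is a Hilbert transform of exp (- i xi w t) K0(xi, w) plus a term of
    constant modulus.  The Hilbert transform of a Hoelder function u with u^2
    integrable is bounded linearly in the Hoelder constant, which here grows at most
    linearly in t; so it suffices that K0(xi, .) is bounded, Hoelder and integrable.
    This is inherited from F0 and phi through Privalov's theorem (the Hilbert
    transform preserves Hoelder continuity), applied to the logarithm of the symbol
    and then to F0 / (exp Gamma (A + B)).  For xi = 0 the transient bracket does not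
    depend on t.  The value of the winding number is never needed: any continuous
    logarithm of the symbol vanishing at both ends is Hoelder and O(1 / |v|), and in
    its absence [log_branch] is 0.  That gd_part has density C0 at time 0 says
    Xi(eta(xi)) = xi, that is, that Xi is onto. *)

(** * Invariance of Lebesgue measure and an integrable kernel *)

Section MeasureAux.
Variable R : realType.
Implicit Types (u f : R -> R).
Notation mu := (@lebesgue_measure R).

(** The gross part wins by an exponential factor, so a polynomial bound in t on the transient
    suffices; no oscillation is exploited and pointwise estimates do. Pairing v + s with v - s
    unfolds a principal value into an absolutely convergent integral. Square-integrability is the
    condition at infinity shared by both uses of the Hilbert transform: the logarithm of the symbol
    decays only like 1/|v| and is in general not integrable, whereas F0 is integrable and, being
    Hölder, bounded. The estimate used here halves the Hölder exponent and says nothing about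
    integrability of the transform; hence exponents are left existential, and the integrability of
    K0 comes from its factors F0 and B. The obstacle is the division by A + B and A - B. At v = 0
    these are xi - sqrt pi and xi + sqrt pi, and both tend to xi at infinity, so a lower bound
    uniform in v requires 0 < |xi| < sqrt pi. This is why xi = 0 takes a separate path. *)

Definition preserves_lebesgue (p : R -> R) :=
  measurable_fun setT p /\
  forall A : set R, measurable A -> mu (p @^-1` A) = mu A.

(** Half-open intervals determine Lebesgue measure, so the pushforward under [p] need only be
    compared with it on them. *)
Lemma preserves_ocitv (p : R -> R) : measurable_fun setT p ->
  (forall a b : R, a < b -> mu (p @^-1` `]a, b]%classic) = mu `]a, b]%classic) ->
  preserves_lebesgue p.
Proof.
move=> mp H; split => // A mA.
pose p' : measurableTypeR R -> measurableTypeR R := p.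
symmetry; apply: (@lebesgue_measure_unique R (pushforward mu p')) => // X.
move=> /ocitvP [->|[[a b] /= ab ->]]; rewrite /pushforward ?preimage_set0 ?measure0 //=.
by rewrite -H.
Qed.

Lemma preserves_addl (c : R) : preserves_lebesgue (fun x => c + x).
Proof.
apply: preserves_ocitv => [|a b ab].
  by apply: continuous_measurable_fun => x; apply: cvgD; [exact: cvg_cst|exact: cvg_id].
have -> : (fun x => c + x) @^-1` `]a, b]%classic = `](a - c), (b - c)]%classic.
  by apply/seteqP; split=> x /=; rewrite !in_itv /= => /andP[? ?]; apply/andP; split; lra.
rewrite !lebesgue_measure_itv /= !lte_fin ab ltrD2r ab -!EFinB; congr EFin; ring.
Qed.

Lemma preserves_subl (c : R) : preserves_lebesgue (fun x => c - x).
Proof.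
apply: preserves_ocitv => [|a b ab].
  by apply: continuous_measurable_fun => x; apply: cvgB; [exact: cvg_cst|exact: cvg_id].
have -> : (fun x => c - x) @^-1` `]a, b]%classic = `[(c - b), (c - a)[%classic.
  by apply/seteqP; split=> x /=; rewrite !in_itv /= => /andP[? ?]; apply/andP; split; lra.
rewrite !lebesgue_measure_itv /= !lte_fin ab ltrD2l ltrN2 ab -!EFinB; congr EFin; ring.
Qed.

Lemma integrable_preserves p f : preserves_lebesgue p ->
  mu.-integrable setT (EFin \o f) ->
  mu.-integrable setT (EFin \o (f \o p)) /\
  \int[mu]_x (f (p x)) = \int[mu]_x (f x).
Proof.
move=> [mp H] intf.
have mf : measurable_fun setT (EFin \o f) by case/integrableP : intf.
pose q : R -> measurableTypeR R := p.
have E (g : measurableTypeR R -> \bar R) : (\int[mu]_x g x = \int[pushforward mu q]_x g x)%E.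
  by apply: eq_measure_integral => A mA _; rewrite /= /pushforward H.
have i2 : mu.-integrable setT (EFin \o (f \o p)).
  apply/integrableP; split; first by apply: (measurableT_comp mf mp).
  case/integrableP : intf => _; apply: le_lt_trans.
  rewrite [leRHS]E ge0_integral_pushforward //; exact: measurableT_comp.
split => //; rewrite /Rintegral; congr fine.
by rewrite [RHS]E integral_pushforward.
Qed.

Notation pos_line := (`]0, +oo[%classic : set R).

(** The half-line is exhausted by the intervals [1/n, n]. On each, the fundamental theorem of
    calculus bounds the integral by 2 C, and monotone convergence passes to the union. *)
Lemma integrable_bounded_primitive (f F : R -> R) (C : R) :
  (forall x : R, 0 < x -> 0 <= f x) ->
  (forall x : R, 0 < x -> {for x, continuous f}) ->
  (forall x : R, 0 < x -> is_derive x 1 F (f x)) ->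
  (forall x : R, 0 < x -> `|F x| <= C) ->
  mu.-integrable pos_line (EFin \o f).
Proof.
move=> f0 cf dF FC.
have mf : measurable_fun pos_line f.
  apply: open_continuous_measurable_fun => // x.
  by rewrite inE /= in_itv /= andbT => x0; exact: cf.
apply/integrableP; split; first exact/measurable_EFinP.
pose I (n : nat) : set R := `[n.+1%:R^-1, n.+1%:R]%classic.
have bigI : pos_line = \bigcup_n I n.
  apply/seteqP; split => x /=.
    rewrite in_itv /= andbT => x0.
    exists (maxn (Num.truncn x) (Num.truncn x^-1)) => //; rewrite /I /= in_itv /=; apply/andP; split.
      rewrite -[leRHS]invrK lef_pV2 ?posrE ?invr_gt0 ?ltr0n //.
      apply: (le_trans (ltW (truncnS_gt x^-1))).
      by rewrite ler_nat ltnS leq_maxr.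
    apply: (le_trans (ltW (truncnS_gt x))).
    by rewrite ler_nat ltnS leq_maxl.
  move=> [n _]; rewrite /I /= !in_itv /= andbT => /andP[h _].
  by apply: lt_le_trans h; rewrite invr_gt0.
have Ipos n x : I n x -> 0 < x.
  by rewrite /I /= in_itv /= => /andP[h _]; apply: lt_le_trans h; rewrite invr_gt0.
have leI n : (\int[mu]_(x in I n) `|(f x)%:E| <= (2 * C)%:E)%E.
  under eq_integral => x.
    rewrite inE => /Ipos x0; rewrite gee0_abs ?lee_fin ?f0 //; over.
  have C0 : 0 <= C by apply: le_trans (FC 1 ltr01).
  (* The interval of index 0 is the single point 1, and the fundamental theorem of calculus requires
     distinct end points. *)
  case: n => [|n].
    rewrite /I invr1 set_itv1 integral_set1 lee_fin; exact: mulr_ge0.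
  have lt1 : (n.+2%:R^-1 < n.+2%:R :> R).
    by apply: (@lt_trans _ _ 1); rewrite ?invf_lt1 ?ltr1n.
  have pos : 0 < n.+2%:R^-1 :> R by rewrite invr_gt0.
  have posx x : n.+2%:R^-1 <= x -> 0 < x by exact: lt_le_trans.
  have cF x : 0 < x -> {for x, continuous F}.
    move=> /dF /= [dFx _]; apply: differentiable_continuous; exact/derivable1_diffP.
  rewrite /I (@continuous_FTC2 R f F) //.
  - rewrite -EFinB lee_fin.
    have := FC _ pos; have := FC n.+2%:R (lt_trans pos lt1).
    by rewrite !ler_norml => /andP[? ?] /andP[? ?]; lra.
  - apply: continuous_in_subspaceT => x; rewrite inE /= in_itv /= => /andP[/posx h _]; exact: cf.
  - split.
    + by move=> x; rewrite in_itv /= => /andP[/ltW/posx/dF[]].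
    + by apply: cvg_at_right_filter; exact: cF.
    + by apply: cvg_at_left_filter; apply: cF; exact: lt_trans lt1.
  - move=> x; rewrite in_itv /= => /andP[/ltW/posx/dF h _].
    by rewrite derive1E; apply: derive_val.
have ndI : nondecreasing_seq I.
  apply/nondecreasing_seqP => n; apply/subsetPset => x; rewrite /I /= !in_itv /= => /andP[h1 h2].
  apply/andP; split; last by apply: le_trans h2 _; rewrite ler_nat.
  by apply: le_trans h1; rewrite lef_pV2 ?posrE ?ltr0n // ler_nat.
have mI n : measurable (I n) by exact: measurable_itv.
have mfI n : measurable_fun (I n) (fun x => `|(f x)%:E|%E).
  apply/measurable_EFinP; apply: measurableT_comp => //.
  by apply: measurable_funS mf => // x /Ipos; rewrite /= in_itv /= andbT.
have cv : ((\int[mu]_(x in I n) `|(f x)%:E|)%E @[n --> \oo] -->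
    \int[mu]_(x in \bigcup_n I n) `|(f x)%:E|)%E.
  exact: ge0_nondecreasing_set_cvg_integral.
rewrite bigI -(cvg_lim _ cv) //.
apply: (@le_lt_trans _ _ (2 * C)%:E%E); last exact: ltry.
by apply: lime_le; [apply/cvg_ex; eexists; exact: cv|exact: nearW].
Qed.

(** [f] is dominated by its restriction to the half-line plus the mirror image of that
    restriction. *)
Lemma even_integrable (f : R -> R) : (forall x, 0 <= f x) ->
  measurable_fun setT f -> (forall x, f (- x) = f x) ->
  mu.-integrable pos_line (EFin \o f) -> mu.-integrable setT (EFin \o f).
Proof.
move=> f0 mf fe intf.
have int1 : mu.-integrable (`[0, +oo[%classic : set R) (EFin \o f).
  apply/integrableP; split; first by apply/measurable_EFinP; exact: measurable_funTS.
  rewrite -integral_itv_obnd_cbnd; first by case/integrableP : intf.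
  by apply/measurable_EFinP; apply: measurableT_comp => //; exact: measurable_funTS.
have int2 : mu.-integrable setT (EFin \o (f \_ `[0, +oo[%classic)).
  rewrite -restrict_EFin. have [+ _] := @integrable_mkcond _ _ R mu (`[0, +oo[%classic : set R) (EFin \o f) (measurable_itv _).
  exact.
have [int3 _] := integrable_preserves (preserves_subl 0) int2.
apply: (le_integrable _ _ _ (integrableD _ int2 int3)) => //.
  exact/measurable_EFinP.
have g0 y : 0 <= (f \_ (`[0, +oo[%classic : set R)) y by rewrite patchE; case: ifP.
move=> x _ /=; rewrite lee_fin [leRHS]ger0_norm ?addr_ge0 ?g0 // ger0_norm //.
case: (leP 0 (x : R)) => x0.
  by rewrite {1}patchE mem_set /= ?in_itv /= ?x0 // lerDl.
rewrite [X in _ <= _ + X]patchE mem_set; last by rewrite /= in_itv /= andbT; lra.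
by rewrite sub0r fe lerDr.
Qed.

(* Comparable to |s|^(b-1) near 0 and to |s|^(-1-b) at infinity; up to the factor b
   it is the derivative of - 1 / (1 + s^b) on s > 0. *)
Definition kap (b s : R) := `|s| `^ (b - 1) / (1 + `|s| `^ b) ^+ 2.

Lemma kap_ge0 b s : 0 <= kap b s.
Proof. by rewrite /kap divr_ge0 ?powR_ge0 ?sqr_ge0. Qed.

Lemma kap_integrable (b : R) : 0 < b -> mu.-integrable setT (EFin \o kap b).
Proof.
move=> b0.
have mabs p : measurable_fun setT (fun x : R => `|x| `^ p).
  by apply: (measurableT_comp (measurable_powR p)).
have pos (x : R) : 0 < 1 + `|x| `^ b by rewrite ltr_pwDl // powR_ge0.
apply: even_integrable => [x||x|]; first exact: kap_ge0.
- apply: measurable_funM; first exact: mabs.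
  have -> : (fun x => ((1 + `|x| `^ b) ^+ 2)^-1) =
            (fun x => (1 + `|x| `^ b) `^ (- 2%:R)) :> (R -> R).
    by apply/funext => x; rewrite powR_invn // ltW.
  apply: (measurableT_comp (measurable_powR _)).
  by apply: measurable_funD.
- by rewrite /kap normrN.
apply: (@integrable_bounded_primitive _ (fun x => - b^-1 * (1 + x `^ b)^-1) b^-1) => x x0.
- exact: kap_ge0.
- have cp p : {for x, continuous (fun y : R => `|y| `^ p)}.
    apply: (continuous_comp (g := fun y => y `^ p)); first exact: norm_continuous.
    apply: differentiable_continuous; apply/derivable1_diffP.
    by apply: derivable_powR; rewrite in_itv /= andbT normr_gt0 gt_eqF.
  apply: cvgM; first exact: cp.
  apply: cvgV; first by rewrite expf_neq0 // gt_eqF.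
  by apply: cvgM; apply: cvgD; try exact: cvg_cst; exact: cp.
- have nz : 1 + x `^ b != 0 by rewrite gt_eqF // ltr_pwDl // powR_ge0.
  have d1 : is_derive x 1 (fun y : R => 1 + y `^ b) (0 + b * x `^ (b - 1)).
    by apply: is_deriveD; exact: is_derive1_powR.
  have d2 := @is_deriveV R (fun y => 1 + y `^ b) x _ 1 nz d1.
  have d3 := is_deriveZ (- b^-1) d2.
  apply: is_derive_eq.
  rewrite /kap (gtr0_norm x0) /GRing.scale /= add0r.
  have b1 : b != 0 by rewrite gt_eqF.
  by field; rewrite nz.
- have p1 : 0 < 1 + x `^ b by rewrite ltr_pwDl // powR_ge0.
  rewrite normrM normrN !gtr0_norm ?invr_gt0 //.
  by rewrite ger_pMr ?invr_gt0 // invf_le1 // lerDl powR_ge0.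
Qed.

End MeasureAux.

(** * The Hilbert transform of a square-integrable Hölder function *)

Section Hilbert.
Variable R : realType.
Implicit Types (u f : R -> R).
Notation mu := (@lebesgue_measure R).

(** Writing 1/x as x times |x|^(-2) reduces the claim to measurability of powers; at 0 both sides
    are 0. *)
Lemma measurable_invr : measurable_fun setT (fun x : R => x^-1).
Proof.
have -> : (fun x : R => x^-1) = (fun x => x * (`|x| `^ (- 2%:R))).
  apply/funext => x; rewrite powR_invn // real_normK ?num_real //.
  by have [->|x0] := eqVneq x 0; [rewrite invr0 mul0r|field].
apply: measurable_funM => //.
exact: (measurableT_comp (measurable_powR _)).
Qed.

Lemma integrable_addr f g : mu.-integrable setT (EFin \o f) ->
  mu.-integrable setT (EFin \o g) ->
  mu.-integrable setT (EFin \o (fun x => f x + g x)).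
Proof. by move=> hf hg; have := integrableD measurableT hf hg; apply: eq_integrable. Qed.

Lemma integrable_mull (k : R) f : mu.-integrable setT (EFin \o f) ->
  mu.-integrable setT (EFin \o (fun x => k * f x)).
Proof. by move=> hf; have := integrableZl measurableT k hf; apply: eq_integrable. Qed.

Lemma integrable_domin f g : measurable_fun setT f ->
  mu.-integrable setT (EFin \o g) -> (forall x, `|f x| <= g x) ->
  mu.-integrable setT (EFin \o f).
Proof.
move=> mf ig fg; apply: le_integrable ig => //; first exact/measurable_EFinP.
by move=> x _ /=; rewrite lee_fin (le_trans (fg x)) // ler_norm.
Qed.

Lemma normr_Rintegral_le f g : measurable_fun setT f ->
  mu.-integrable setT (EFin \o g) -> (forall x, `|f x| <= g x) ->
  `|\int[mu]_x f x| <= \int[mu]_x g x.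
Proof.
move=> mf ig fg; have intf := integrable_domin mf ig fg.
apply: (le_trans (le_normr_Rintegral measurableT intf)).
by apply: le_Rintegral => //; exact: integrable_norm.
Qed.

(** The 4 bounds (1 + |s|^b)^2, since |s|^b <= 1 here. *)
Lemma kap_near0 (b s : R) : 0 <= b -> s != 0 -> `|s| <= 1 ->
  `|s| `^ (b - 1) <= 4 * kap b s.
Proof.
move=> b0 s0 s1; rewrite /kap mulrCA ler_peMr ?powR_ge0 //.
have : `|s| `^ b <= 1.
  by rewrite -[leRHS](powRr0 `|s|) ger_powR // normr_gt0 s0.
have := powR_ge0 `|s| b; set t := _ `^ b => t0 t1.
rewrite ler_pdivlMr; last by rewrite exprn_gt0 // ltr_pwDl.
by nra.
Qed.

(** With t = |s|^b >= 1 the claim amounts to (1 + t)^2 <= 4 t^2. *)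
Lemma kap_far (b s : R) : 0 <= b -> 1 <= `|s| ->
  `|s| `^ (- 1 - b) <= 4 * kap b s.
Proof.
move=> b0 s1; rewrite /kap.
have s0 : 0 < `|s| by exact: lt_le_trans s1.
have snz : `|s| != 0 by rewrite gt_eqF.
have e1 : `|s| `^ (b - 1) = `|s| `^ b / `|s| by rewrite powRB ?snz ?implybT // powRr1.
have e2 : `|s| `^ (-1 - b) = `|s|^-1 / `|s| `^ b.
  by rewrite powRB ?snz ?implybT // powR_inv1.
rewrite e1 e2.
have : 1 <= `|s| `^ b by rewrite -[leLHS](powRr0 `|s|) ler_powR.
set t := _ `^ b => t1.
rewrite ler_pdivrMr; last by lra.
rewrite -subr_ge0.
have -> : 4 * (t / `|s| / (1 + t) ^+ 2) * t - `|s|^-1 =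
  `|s|^-1 * ((2 * t - (1 + t)) * (2 * t + (1 + t))) / (1 + t) ^+ 2.
  by field; rewrite snz andbT gt_eqF //; lra.
have h : 0 <= (2 * t - (1 + t)) * (2 * t + (1 + t)) by apply: mulr_ge0; lra.
apply: divr_ge0; last exact: sqr_ge0.
by apply: mulr_ge0 => //; rewrite invr_ge0.
Qed.

Definition holder_bound (a M : R) u :=
  forall x y, `|u x - u y| <= M * `|x - y| `^ a.

Definition square_integrable u := mu.-integrable setT (EFin \o (fun x => u x ^+ 2)).

Lemma holder_bound_continuous (a M : R) u : 0 < a -> holder_bound a M u ->
  continuous u.
Proof.
move=> a0 H x; apply/cvgrPdist_le => e e0.
have M1 : 0 < `|M| + 1 by rewrite ltr_wpDl.
pose d := (e / (`|M| + 1)) `^ a^-1.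
have d0 : 0 < d by rewrite powR_gt0 // divr_gt0.
near=> y.
have xy : `|x - y| <= d by near: y; apply: cvgr_dist_le => //; exact: cvg_id.
apply: (le_trans (H x y)); apply: (@le_trans _ _ ((`|M| + 1) * (e / (`|M| + 1)))).
  apply: (@le_trans _ _ ((`|M| + 1) * `|x - y| `^ a)).
    by rewrite ler_wpM2r ?powR_ge0 // (le_trans (ler_norm M)) // lerDl.
  rewrite ler_wpM2l ?(ltW M1) //.
  have -> : e / (`|M| + 1) = d `^ a by rewrite -powRrM mulVf ?gt_eqF // powRr1 // divr_ge0 // ltW.
  by apply: (ge0_ler_powR (ltW a0)); rewrite ?nnegrE // ltW.
by rewrite mulrC divfK // gt_eqF.
Unshelve. all: by end_near. Qed.

Section Fixed.
Variables (a M : R) (u : R -> R).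
Hypotheses (a0 : 0 < a) (a1 : a <= 1) (M1 : 1 <= M).
Hypothesis (Hu : holder_bound a M u) (u2 : square_integrable u).

Definition diffq v s := (u (v + s) - u (v - s)) / s.

Lemma measurable_holder : measurable_fun setT u.
Proof. apply: continuous_measurable_fun; exact: holder_bound_continuous Hu. Qed.

Lemma square_integrable_addl c :
  mu.-integrable setT (EFin \o (fun s => u (c + s) ^+ 2)) /\
  \int[mu]_s (u (c + s) ^+ 2) = \int[mu]_s (u s ^+ 2).
Proof. exact: (integrable_preserves (preserves_addl c) u2). Qed.

Lemma square_integrable_subl c :
  mu.-integrable setT (EFin \o (fun s => u (c - s) ^+ 2)) /\
  \int[mu]_s (u (c - s) ^+ 2) = \int[mu]_s (u s ^+ 2).
Proof. exact: (integrable_preserves (preserves_subl c) u2). Qed.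

Lemma measurable_diffq v : measurable_fun setT (diffq v).
Proof.
apply: measurable_funM; last exact: measurable_invr.
apply: measurable_funB; apply: (measurableT_comp measurable_holder).
  exact: measurable_funD.
exact: measurable_funB.
Qed.

Lemma powR2_le (s : R) : (2 * `|s|) `^ a <= 2 * `|s| `^ a.
Proof.
rewrite powRM // ler_pM ?powR_ge0 //.
rewrite -[leRHS](@powRr1 _ 2) //; apply: ler_powR => //; lra.
Qed.

(** For |s| <= 1 the Hölder bound leaves |s|^(a-1), which [kap a] dominates. For larger |s|, p q <=
    p^2 + q^2 separates the numerator from 1/|s|; the squares of [u] and |s|^(-2) remain, the latter
    dominated by [kap 1]. Every term on the right is integrable in [s]. *)
Lemma diffq_le v s : `|diffq v s| <=
  8 * M * kap a s + 2 * (u (v + s) ^+ 2 + u (v - s) ^+ 2) + 4 * kap 1 s.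
Proof.
have k0 := kap_ge0 a s; have k1 := kap_ge0 1 s.
have q1 := sqr_ge0 (u (v + s)); have q2 := sqr_ge0 (u (v - s)).
have Mk : 0 <= M * kap a s by rewrite mulr_ge0 // (le_trans ler01 M1).
have [e|s0] := eqVneq s 0.
  have -> : diffq v s = 0 by rewrite /diffq e invr0 mulr0.
  rewrite normr0; lra.
have s0' : 0 < `|s| by rewrite normr_gt0.
have [s1|s1] := leP `|s| 1.
  have H := Hu (v + s) (v - s).
  have e : v + s - (v - s) = 2 * s by ring.
  rewrite e normrM (@ger0_norm _ 2) // in H.
  have h2 : `|diffq v s| <= 2 * M * `|s| `^ (a - 1).
    have e2 : `|s| `^ (a - 1) * `|s| = `|s| `^ a by rewrite mulrC mulr_powRB1.
    rewrite /diffq normrM normfV ler_pdivrMr // -!mulrA e2.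
    by apply: (le_trans H); rewrite mulrCA ler_wpM2l ?(le_trans ler01 M1) // powR2_le.
  have h3 : M * `|s| `^ (a - 1) <= M * (4 * kap a s).
    by rewrite ler_wpM2l ?(le_trans ler01 M1) // kap_near0 // ltW.
  rewrite -!mulrA in h2 Mk *; lra.
have := kap_far ler01 (ltW s1).
have -> : -1 - 1 = - 2%:R :> R by ring.
rewrite powR_invn // => h.
have : `|diffq v s| <= `|u (v + s) - u (v - s)| ^+ 2 + `|s| ^- 2.
  rewrite /diffq normrM normfV.
  have := sqr_ge0 (`|u (v + s) - u (v - s)| - `|s|^-1).
  rewrite -exprVn; have : 0 <= `|s|^-1 by rewrite invr_ge0.
  have := normr_ge0 (u (v + s) - u (v - s)).
  by set p := `|_|; set q := `|_|^-1; nra.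
rewrite real_normK ?num_real //.
have := sqr_ge0 (u (v + s) + u (v - s)).
by nra.
Qed.

Lemma integrable_diffq v : mu.-integrable setT (EFin \o diffq v).
Proof.
have [i1 _] := square_integrable_addl v; have [i2 _] := square_integrable_subl v.
have ka := kap_integrable a0; have k1 := kap_integrable (@ltr01 R).
apply: (integrable_domin (measurable_diffq v) _ (diffq_le v)).
apply: integrable_addr; last exact: integrable_mull.
apply: integrable_addr; first exact: integrable_mull.
by apply: integrable_mull; exact: integrable_addr.
Qed.

(* The singularity is removed by averaging over s and -s, whence the factor 1/2. *)
Definition hilb v := 2^-1 * \int[mu]_s diffq v s.

(** The integrals of the shifted squares do not depend on [v], whence a bound uniform in [v]. The
    constant is kept explicit because later [M] depends on t while the other terms are bounded
    independently of t. *)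
Lemma hilb_le v : `|hilb v| <=
  4 * M * (\int[mu]_s kap a s) + 2 * (\int[mu]_s (u s ^+ 2)) + 2 * (\int[mu]_s kap 1 s).
Proof.
have [i1 e1] := square_integrable_addl v; have [i2 e2] := square_integrable_subl v.
have ka := kap_integrable a0; have k1 := kap_integrable (@ltr01 R).
have i12 := integrable_addr i1 i2.
have A1 := integrable_mull (8 * M) ka; have A2 := integrable_mull 2 i12.
have A3 := integrable_mull 4 k1.
have := normr_Rintegral_le (measurable_diffq v)
  (integrable_addr (integrable_addr A1 A2) A3) (diffq_le v).
rewrite !RintegralD //; last exact: integrable_addr.
rewrite !RintegralZl // RintegralD // e1 e2 => h.
rewrite /hilb normrM gtr0_norm ?invr_gt0 //.
move: h; set j0 := Rintegral _ _ _; set j1 := Rintegral _ _ _.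
by set j2 := Rintegral _ _ _; set j3 := Rintegral _ _ _ => h; lra.
Qed.

(* Interpolation: for |s| <= 1 the numerator is bounded both by |v - v'|^a and by
   |s|^a, hence by the geometric mean; for |s| >= 1 half of the power of the
   numerator goes into |v - v'|^(a/2) and Young's inequality y q^3 <= y^4 + q^4,
   with q = |s|^(-1/3), treats the other half. *)
Lemma diffqB_le v v' s : `|diffq v s - diffq v' s| <=
  M * `|v - v'| `^ (a / 2) *
  (16 * kap (a / 2) s + 8 * kap 3^-1 s +
   8 * ((u (v + s) ^+ 2 + u (v - s) ^+ 2) + (u (v' + s) ^+ 2 + u (v' - s) ^+ 2))).
Proof.
have M0 : 0 <= M := le_trans ler01 M1.
have k1 := kap_ge0 (a / 2) s; have k2 := kap_ge0 3^-1 s.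
have d0 := powR_ge0 `|v - v'| (a / 2).
set q := (X in _ + 8 * X).
have q0 : 0 <= q by rewrite /q; apply: addr_ge0; apply: addr_ge0; exact: sqr_ge0.
pose D := (u (v + s) - u (v - s)) - (u (v' + s) - u (v' - s)).
have DE : diffq v s - diffq v' s = D / s by rewrite /diffq -mulrBl.
have Dq : D ^+ 2 <= 4 * q.
  rewrite /D /q; set x1 := u _; set x2 := u _; set x3 := u _; set x4 := u _.
  have := sqr_ge0 (x1 + x2); have := sqr_ge0 (x1 + x3); have := sqr_ge0 (x1 - x4).
  have := sqr_ge0 (x2 - x3); have := sqr_ge0 (x2 + x4); have := sqr_ge0 (x3 + x4).
  by rewrite !expr2; lra.
set d := `|v - v'| `^ (a / 2) in d0 *.
have dd : `|v - v'| `^ a = d ^+ 2.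
  by rewrite -powR_mulrn ?powR_ge0 // -powRrM divfK.
have Dd : `|D| <= 2 * M * d ^+ 2.
  have h1 := Hu (v + s) (v' + s); have h2 := Hu (v - s) (v' - s).
  have e1 : v + s - (v' + s) = v - v' by ring.
  have e2 : v - s - (v' - s) = v - v' by ring.
  rewrite e1 dd in h1; rewrite e2 dd in h2.
  have -> : D = (u (v + s) - u (v' + s)) - (u (v - s) - u (v' - s)) by rewrite /D; ring.
  apply: (le_trans (ler_normB _ _)); lra.
rewrite DE normrM normfV.
have [e|s0] := eqVneq s 0.
  rewrite e normr0 invr0 mulr0.
  by apply: mulr_ge0; [exact: mulr_ge0|rewrite !addr_ge0 ?mulr_ge0 ?kap_ge0].
have s0' : 0 < `|s| by rewrite normr_gt0.
have [s1|s1] := leP `|s| 1.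
  set t := `|s| `^ (a / 2).
  have t0 : 0 <= t := powR_ge0 _ _.
  have tt : `|s| `^ a = t ^+ 2.
    by rewrite -powR_mulrn ?powR_ge0 // -powRrM divfK.
  have Dt : `|D| <= 4 * M * t ^+ 2.
    have h1 := Hu (v + s) (v - s); have h2 := Hu (v' + s) (v' - s).
    have e1 : v + s - (v - s) = 2 * s by ring.
    have e2 : v' + s - (v' - s) = 2 * s by ring.
    have e3 : `|2 * s| = 2 * `|s| by rewrite normrM ger0_norm.
    rewrite e1 e3 in h1; rewrite e2 e3 in h2.
    have h3 : M * (2 * `|s|) `^ a <= M * (2 * t ^+ 2).
      by rewrite ler_wpM2l // -tt powR2_le.
    apply: (le_trans (ler_normB _ _)); lra.
  have Ddt : `|D| <= 4 * M * (d * t).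
    rewrite -ler_sqr ?nnegrE ?mulr_ge0 //.
    have -> : (4 * M * (d * t)) ^+ 2 = (4 * M * d ^+ 2) * (4 * M * t ^+ 2) by ring.
    rewrite expr2; apply: ler_pM => //; apply: (le_trans Dd).
    by rewrite ler_wpM2r ?sqr_ge0 // ler_wpM2r //; lra.
  have tk : t / `|s| <= 4 * kap (a / 2) s.
    have a20 : 0 <= a / 2 by rewrite divr_ge0 // ltW.
    apply: le_trans (kap_near0 a20 s0 s1); rewrite powRB ?(gt_eqF s0') ?implybT //.
    by rewrite powRr1.
  apply: (@le_trans _ _ (4 * M * d * (t / `|s|))).
    by rewrite mulrA ler_wpM2r ?invr_ge0 // -mulrA.
  apply: (@le_trans _ _ (4 * M * d * (4 * kap (a / 2) s))).
    by rewrite ler_wpM2l // !mulr_ge0.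
  have -> : 4 * M * d * (4 * kap (a / 2) s) = M * d * (16 * kap (a / 2) s) by ring.
  by rewrite ler_wpM2l ?mulr_ge0 //; lra.
pose y := Num.sqrt `|D|.
have y0 : 0 <= y := sqrtr_ge0 _.
have yy : `|D| = y ^+ 2 by rewrite sqr_sqrtr.
(* Since 1 <= M, sqrt (2 M) is at most 2 M, so [M] enters as a plain factor. *)
have yd : y <= 2 * M * d.
  rewrite -ler_sqr ?nnegrE ?mulr_ge0 // -yy; apply: (le_trans Dd).
  have -> : (2 * M * d) ^+ 2 = 2 * M * d ^+ 2 * (2 * M) by ring.
  by rewrite ler_peMr ?mulr_ge0 ?sqr_ge0 //; have := M1; lra.
pose w := `|s| `^ (- 3^-1).
have w0 : 0 <= w := powR_ge0 _ _.
have w3 : `|s|^-1 = w ^+ 3.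
  rewrite /w -powR_mulrn ?powR_ge0 // -powRrM -[LHS]powR_inv1 ?(ltW s0') //; congr (_ `^ _).
  by field.
have w4 : w ^+ 4 <= 4 * kap 3^-1 s.
  have i3 : 0 <= 3^-1 :> R by rewrite invr_ge0.
  apply: le_trans (kap_far i3 (ltW s1)).
  rewrite /w -powR_mulrn ?powR_ge0 // -powRrM.
  by rewrite (_ : - 3^-1 * 4%:R = -1 - 3^-1) //; field.
have yw : y * w ^+ 3 <= y ^+ 4 + w ^+ 4.
  have [yw|/ltW yw] := leP y w.
    rewrite (exprS w 3); apply: (@le_trans _ _ (w * w ^+ 3)).
      by rewrite ler_wpM2r ?exprn_ge0.
    by rewrite lerDr exprn_ge0.
  rewrite (exprS y 3); apply: (@le_trans _ _ (y * y ^+ 3)).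
    by rewrite ler_wpM2l // lerXn2r ?nnegrE.
  by rewrite lerDl exprn_ge0.
have y4 : y ^+ 4 = D ^+ 2 by rewrite (exprM y 2 2) -yy real_normK ?num_real.
rewrite yy w3.
have -> : y ^+ 2 * w ^+ 3 = y * (y * w ^+ 3) by ring.
apply: (@le_trans _ _ (2 * M * d * (y ^+ 4 + w ^+ 4))).
  by apply: ler_pM => //; rewrite mulr_ge0 ?exprn_ge0.
have -> : 2 * M * d * (y ^+ 4 + w ^+ 4) = M * d * (2 * (y ^+ 4 + w ^+ 4)) by ring.
by rewrite ler_wpM2l ?mulr_ge0 //; lra.
Qed.

(** Privalov's theorem with a loss: half of the exponent is spent on making the bound integrable in
    [s]. The loss is harmless, as any positive exponent serves later. *)
Lemma hilb_holder : holder_bound (a / 2)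
  (M * (8 * (\int[mu]_s kap (a / 2) s) + 4 * (\int[mu]_s kap 3^-1 s) +
   16 * (\int[mu]_s (u s ^+ 2)))) hilb.
Proof.
move=> v v'.
have [i1 e1] := square_integrable_addl v; have [i2 e2] := square_integrable_subl v.
have [i3 e3] := square_integrable_addl v'; have [i4 e4] := square_integrable_subl v'.
have ka : mu.-integrable setT (EFin \o kap (a / 2)) by apply: kap_integrable; rewrite divr_gt0.
have k1 : mu.-integrable setT (EFin \o @kap R 3^-1) by apply: kap_integrable; rewrite invr_gt0.
have i12 := integrable_addr i1 i2; have i34 := integrable_addr i3 i4.
have i14 := integrable_addr i12 i34.
have A1 := integrable_mull 16 ka; have A2 := integrable_mull 8 k1.
have A3 := integrable_mull 8 i14; have A12 := integrable_addr A1 A2.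
have md : measurable_fun setT (fun s => diffq v s - diffq v' s).
  by apply: measurable_funB; exact: measurable_diffq.
have A := integrable_addr A12 A3.
have := normr_Rintegral_le md (integrable_mull _ A) (diffqB_le v v').
rewrite (RintegralB measurableT (integrable_diffq v) (integrable_diffq v')).
rewrite RintegralZl // !RintegralD // !RintegralZl // !RintegralD //.
rewrite e1 e2 e3 e4.
rewrite /hilb -mulrBr normrM (@gtr0_norm _ 2^-1) ?invr_gt0 // => h.
set d := _ `^ _ in h *; set x := `|_| in h *.
set j1 := Rintegral _ _ _ in h *; set j2 := Rintegral _ _ _ in h *.
set j3 := Rintegral _ _ _ in h *.
by lra.
Qed.

End Fixed.
End Hilbert.

(** * Principal values as Hilbert transforms *)

Section PrincipalValue.
Variable R : realType.
Notation mu := (@lebesgue_measure R).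
Variables (a M : R) (u : R -> R).
Hypotheses (a0 : 0 < a) (a1 : a <= 1) (M1 : 1 <= M).
Hypothesis (Hu : holder_bound a M u) (u2 : square_integrable u).

(** The integrand is extended by 0 across the excised interval, so that invariance of integrals over
    the whole line under translation and reflection applies. *)
Definition trunc (e v : R) (w : R) : R := if e < `|w - v| then u w / (w - v) else 0.

Lemma measurable_outer (e v : R) : measurable [set w : R | e < `|w - v|].
Proof.
rewrite (_ : [set w | _] = ~` `[v - e, v + e]%classic).
  by apply: measurableC; exact: measurable_itv.
apply/seteqP; split => w /=; rewrite in_itv /= ltNge ler_distl => h.
  exact/negP.
exact/negP.
Qed.

Lemma truncE (e v : R) : (fun w => u w / (w - v)) \_ [set w : R | e < `|w - v|] = trunc e v.
Proof.
apply/funext => w; rewrite patchE /trunc.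
case: ifPn => [|/negP]; rewrite inE /= => h; first by rewrite h.
by move/negP/negbTE : h => ->.
Qed.

Lemma measurable_trunc (e v : R) : measurable_fun setT (trunc e v).
Proof.
rewrite -truncE; apply/(measurable_restrictT _ (measurable_outer e v)).
apply: measurable_funTS; apply: measurable_funM; first exact: measurable_holder Hu.
apply: (measurableT_comp (@measurable_invr R)); exact: measurable_funB.
Qed.

(** As in [diffq_le], the quotient is at most the sum of the squares of [u w] and 1/(w - v), and the
    latter is integrable away from [v]. *)
Lemma integrable_trunc (e v : R) : 0 < e ->
  mu.-integrable setT (EFin \o trunc e v).
Proof.
move=> e0.
have k1 := kap_integrable (@ltr01 R).
have [k2 _] := integrable_preserves (preserves_addl (- v)) k1.
have A := integrable_addr u2 (integrable_mull ((1 + e^-1) ^+ 2) k2).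
apply: (integrable_domin (measurable_trunc e v) A) => w.
have k0 : 0 <= (1 + e^-1) ^+ 2 * kap 1 (- v + w) by rewrite mulr_ge0 ?sqr_ge0 ?kap_ge0.
rewrite /trunc /= [- v + w]addrC in k0 *; case: ifPn => [h|_]; last first.
  by rewrite normr0 addr_ge0 // sqr_ge0.
have w0 : 0 < `|w - v| by exact: lt_trans h.
set x := `|w - v| in w0 h.
(* [kap 1] at distance x is (1 + x)^(-2), and (1 + 1/x)^2 decreases in x; its value at [e] is the
   constant. *)
have wk : x ^- 2 <= (1 + e^-1) ^+ 2 * kap 1 (w - v).
  rewrite /kap subrr powRr0 -/x powRr1 ?(ltW w0) // mul1r -(ler_pM2r (x := (1 + x) ^+ 2)); last first.
    by rewrite exprn_gt0 // addr_gt0.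
  rewrite divfK; last by rewrite gt_eqF // exprn_gt0 // addr_gt0.
  have -> : x ^- 2 * (1 + x) ^+ 2 = (1 + x^-1) ^+ 2 by field; rewrite gt_eqF.
  rewrite lerXn2r ?nnegrE ?addr_ge0 ?invr_ge0 ?(ltW w0) ?(ltW e0) //.
  by rewrite lerD2l lef_pV2 ?posrE // ltW.
apply: (le_trans _ (lerD (lexx _) wk)).
rewrite normrM normfV -/x -exprVn -(@real_normK _ (u w)) ?num_real //.
have : 0 <= x^-1 by rewrite invr_ge0 ltW.
have := normr_ge0 (u w); set p := `|_|; set q := x^-1 => p0 q0.
by have := sqr_ge0 (p - q); nra.
Qed.

(** The truncated integral is computed twice, with w = v + s and with w = v - s; half of the sum is
    the truncated integral of [diffq]. *)
Lemma Rintegral_trunc (e v : R) : 0 < e ->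
  \int[mu]_(w in [set w : R | e < `|w - v|]) (u w / (w - v)) =
  2^-1 * \int[mu]_s (if e < `|s| then diffq u v s else 0).
Proof.
move=> e0; rewrite Rintegral_mkcond truncE.
have int0 := integrable_trunc v e0.
have [i1 e1] := integrable_preserves (preserves_addl v) int0.
have [i2 e2] := integrable_preserves (preserves_subl v) int0.
have -> : (fun s => if e < `|s| then diffq u v s else 0) =
  (fun s => trunc e v (v + s) + trunc e v (v - s)).
  apply/funext => s; rewrite /trunc.
  have -> : v + s - v = s by ring.
  have -> : v - s - v = - s by ring.
  rewrite normrN; case: ifPn => _; last by rewrite addr0.
  by rewrite /diffq invrN mulrN mulrBl.
by rewrite RintegralD // e1 e2 -mulr2n -[X in 2^-1 * X]mulr_natl mulrA mulVf ?mul1r ?pnatr_eq0.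
Qed.

(** Dominated convergence along sequences tending to 0 from the right, with majorant |diffq u v|. At
    s = 0 the truncations and their limit are all 0, because division by 0 gives 0. *)
Lemma pv_hilb v :
  \int[mu]_(w in [set w : R | e < `|w - v|]) (u w / (w - v)) @[e --> 0^'+]
    --> hilb u v.
Proof.
apply/cvg_at_rightP => e [e0 ecv].
under eq_fun do rewrite Rintegral_trunc //.
apply: cvgM; first exact: cvg_cst.
have mq := measurable_diffq a0 Hu v.
have iq := integrable_diffq a0 a1 M1 Hu u2 v.
pose f n s := if e n < `|s| then diffq u v s else 0.
have mf n : measurable_fun setT (f n).
  have -> : f n = diffq u v \_ [set w : R | e n < `|w|].
    apply/funext => s; rewrite patchE /f.
    case: (ifPn (s \in _)) => [|/negP]; rewrite inE /= => h; first by rewrite h.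
    by move/negP/negbTE : h => ->.
  have mo : measurable [set w : R | e n < `|w|].
    by have := measurable_outer (e n) 0; under eq_set do rewrite subr0.
  apply/(measurable_restrictT _ mo).
  exact: measurable_funTS.
have fl (s : R) : (f n s)%:E @[n --> \oo] --> (diffq u v s)%:E.
  have [s0|s0] := eqVneq s 0.
    rewrite (_ : (fun n => _) = cst (diffq u v s)%:E); first exact: cvg_cst.
    by apply/funext => n; rewrite /f s0 normr0 ltNge ltW // /diffq invr0 mulr0.
  apply: cvg_near_cst; near=> n; rewrite /f ifT //.
  near: n; have s0' : 0 < `|s| by rewrite normr_gt0.
  by move/cvgrPdist_lt : ecv => /(_ _ s0'); apply: filterS => n; rewrite sub0r normrN gtr0_norm.
have fb (s : R) n : (`|(f n s)%:E| <= (`|diffq u v s|)%:E)%E.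
  by rewrite lee_fin /f; case: ifPn => // _; rewrite normr0.
pose fn n := EFin \o f n; pose D := EFin \o diffq u v.
pose G := EFin \o (fun s => `|diffq u v s|).
have ae1 : {ae mu, forall x, setT x -> fn ^~ x @ \oo --> D x}.
  by apply: aeW => s _; exact: fl.
have ae2 : {ae mu, forall x n, setT x -> (`|fn n x| <= G x)%E}.
  by apply: aeW => s n _; exact: fb.
have [_ _] := @dominated_convergence _ _ _ mu setT measurableT
  fn D G
  (fun n => (measurable_EFinP _ _).2 (mf n)) ((measurable_EFinP _ _).2 mq)
  ae1 (integrable_norm iq) ae2.
move=> h; apply: fine_cvg; rewrite fineK; first exact: h.
exact: integrable_fin_num.
Unshelve. all: by end_near. Qed.

End PrincipalValue.

(** * Complex-valued bounded Hölder functions *)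

Section ComplexNorm.
Variable R : realType.
Implicit Types (z w : R[i]) (x y : R).

Lemma normc_ge0 z : 0 <= normc z.
Proof. by case: z => x y; exact: sqrtr_ge0. Qed.

Lemma normcD_le z w : normc (z + w) <= normc z + normc w.
Proof. exact: (@le_normcD R z w). Qed.

Lemma normc_opp z : normc (- z) = normc z.
Proof. exact: (@normcN R z). Qed.

Lemma normcB_le z w : normc (z - w) <= normc z + normc w.
Proof. by rewrite -(normc_opp w) normcD_le. Qed.

Lemma normcBC z w : normc (z - w) = normc (w - z).
Proof. by rewrite -normc_opp opprB. Qed.

Lemma normRe_le z : `|complex.Re z| <= normc z.
Proof. by case: z => x y /=; rewrite -sqrtr_sqr ler_wsqrtr // lerDl sqr_ge0. Qed.

Lemma normIm_le z : `|complex.Im z| <= normc z.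
Proof. by case: z => x y /=; rewrite -sqrtr_sqr ler_wsqrtr // lerDr sqr_ge0. Qed.

Lemma normcR x : normc x%:C = `|x|.
Proof. by rewrite /= expr0n /= addr0 sqrtr_sqr. Qed.

Lemma normc_i : normc ('i : R[i]) = 1.
Proof. by rewrite /= expr0n /= add0r expr1n sqrtr1. Qed.

Lemma normc_le_ReIm z : normc z <= `|complex.Re z| + `|complex.Im z|.
Proof.
rewrite {1}[z]complexE; apply: (le_trans (normcD_le _ _)).
by rewrite normcM normc_i mul1r !normcR.
Qed.

Lemma normc_sq z : normc z ^+ 2 = complex.Re z ^+ 2 + complex.Im z ^+ 2.
Proof. by case: z => x y /=; rewrite sqr_sqrtr // addr_ge0 ?sqr_ge0. Qed.

Lemma complex_ReB z w : complex.Re (z - w) = complex.Re z - complex.Re w.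
Proof. by case: z w => [? ?] []. Qed.

Lemma complex_ImB z w : complex.Im (z - w) = complex.Im z - complex.Im w.
Proof. by case: z w => [? ?] []. Qed.

Lemma complex_ReM z w : complex.Re (z * w) =
  complex.Re z * complex.Re w - complex.Im z * complex.Im w.
Proof. by case: z w => [? ?] []. Qed.

Lemma complex_ImM z w : complex.Im (z * w) =
  complex.Re z * complex.Im w + complex.Im z * complex.Re w.
Proof. by case: z w => [? ?] []. Qed.

Lemma Re_divR z x : complex.Re (z / x%:C) = complex.Re z / x.
Proof. by rewrite -fmorphV complex_ReM /= mulr0 subr0. Qed.

Lemma Im_divR z x : complex.Im (z / x%:C) = complex.Im z / x.
Proof. by rewrite -fmorphV complex_ImM /= mulr0 add0r. Qed.

Lemma normc_cexp z : normc (cexp z) = expR (complex.Re z).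
Proof.
rewrite /cexp /= !exprMn -mulrDr cos2Dsin2 mulr1 sqrtr_sqr ger0_norm //.
Qed.

Lemma lip_derive (f df : R -> R) : (forall x, is_derive x 1 f (df x)) ->
  (forall x, `|df x| <= 1) -> forall x y, `|f x - f y| <= `|x - y|.
Proof.
move=> fd df1; suff h x y : x <= y -> `|f x - f y| <= `|x - y|.
  move=> x y; have [/h//|/ltW/h] := leP x y.
  by rewrite distrC (distrC x).
move=> xy; have [|c _ e] := @MVT_segment R f df x y xy (fun t _ => fd t).
  apply: derivable_within_continuous => t _; exact: ex_derive.
by rewrite distrC e normrM (distrC x) ler_piMl.
Qed.

Lemma cos_lip x y : `|cos x - cos y| <= `|x - y|.
Proof.
apply: (@lip_derive _ (fun x => - sin x)) => {}x.
by rewrite normrN sin_max.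
Qed.

Lemma sin_lip x y : `|sin x - sin y| <= `|x - y|.
Proof.
apply: (@lip_derive _ cos) => {}x.
exact: cos_max.
Qed.

Lemma expR_lip (M x y : R) : x <= M -> y <= M ->
  `|expR x - expR y| <= expR M * `|x - y|.
Proof.
suff h a b : a <= b -> b <= M -> `|expR a - expR b| <= expR M * `|a - b|.
  move=> xM yM; have [xy|/ltW yx] := leP x y; first exact: h.
  by rewrite distrC (distrC x); exact: h.
move=> ab bM; rewrite !ler0_norm ?subr_le0 ?ler_expR // !opprB.
have e1 : expR a = expR b * expR (a - b) by rewrite -expRD addrC subrK.
have := expR_ge1Dx (a - b); have := expR_gt0 b.
have bM' : expR b <= expR M by rewrite ler_expR.
by rewrite e1; set p := expR (a - b); nra.
Qed.

Lemma cexp_lip (M : R) z w : normc z <= M -> normc w <= M ->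
  normc (cexp z - cexp w) <= 4 * expR M * normc (z - w).
Proof.
move=> zM wM.
have hz := le_trans (normRe_le z) zM; have hw := le_trans (normRe_le w) wM.
have hr : `|complex.Re z - complex.Re w| <= normc (z - w) by rewrite -complex_ReB normRe_le.
have hi : `|complex.Im z - complex.Im w| <= normc (z - w) by rewrite -complex_ImB normIm_le.
have rz : complex.Re z <= M := le_trans (ler_norm _) hz.
have rw : complex.Re w <= M := le_trans (ler_norm _) hw.
have he := expR_lip rz rw.
have hez : expR (complex.Re z) <= expR M by rewrite ler_expR.
have M0 := expR_gt0 M.
have aux (c : R -> R) : (forall x y, `|c x - c y| <= `|x - y|) -> (forall x, `|c x| <= 1) ->
    `|expR (complex.Re z) * c (complex.Im z) - expR (complex.Re w) * c (complex.Im w)|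
      <= 2 * expR M * normc (z - w).
  move=> lc c1.
  rewrite (_ : _ - _ = expR (complex.Re z) * (c (complex.Im z) - c (complex.Im w)) +
     (expR (complex.Re z) - expR (complex.Re w)) * c (complex.Im w)); last by ring.
  apply: (le_trans (ler_normD _ _)); rewrite !normrM.
  have -> : 2 * expR M * normc (z - w) = expR M * normc (z - w) + expR M * normc (z - w) * 1.
    by ring.
  apply: lerD; apply: ler_pM => //.
  - by rewrite gtr0_norm ?expR_gt0.
  - exact: le_trans (lc _ _) hi.
  - by apply: (le_trans he); rewrite ler_wpM2l // ltW.
apply: (le_trans (normc_le_ReIm _)); rewrite complex_ReB complex_ImB /cexp /=.
have -> : 4 * expR M * normc (z - w) = 2 * expR M * normc (z - w) + 2 * expR M * normc (z - w).
  by ring.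
apply: lerD; apply: aux => x.
- exact: cos_lip.
- exact: cos_max.
- exact: sin_lip.
- exact: sin_max.
Qed.

End ComplexNorm.

(** * The algebra of bounded Hölder functions *)

Section BoundedHolder.
Variable R : realType.
Notation mu := (@lebesgue_measure R).
Implicit Types f g h : R -> R[i].

(** One constant bounds both the values and the Hölder quotient; [1 <= M] is the normalisation
    assumed by the estimates of the Hilbert transform. *)
Definition bholder_with (a M : R) f := [/\ 0 < a, a <= 1, 1 <= M,
  forall x, normc (f x) <= M &
  forall x y, normc (f x - f y) <= M * `|x - y| `^ a].

Definition bholder f := exists a M, bholder_with a M f.

Lemma powR_dist_le (a b d : R) : 0 < b -> b <= a -> 0 <= d -> d <= 1 ->
  d `^ a <= d `^ b.
Proof.
move=> b0 ba; rewrite le_eqVlt => /predU1P[<- _|d0 d1]; last first.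
  by rewrite ger_powR // d0 d1.
by rewrite !powR0 // gt_eqF // (lt_le_trans b0).
Qed.

(** At distances up to 1 a smaller exponent gives a larger power; beyond 1 the increment is at most
    twice the bound on the values, whence the factor 2. *)
Lemma bholder_with_weaken (a M b N : R) f : 0 < b -> b <= a -> 2 * M <= N ->
  bholder_with a M f -> bholder_with b N f.
Proof.
move=> b0 ba MN [a0 a1 M1 fM Hf]; split => //; [exact: le_trans a1|lra| |].
  move=> x; apply: (le_trans (fM x)); lra.
move=> x y; have [d1|/ltW d1] := leP `|x - y| 1.
  apply: (le_trans (Hf x y)); apply: ler_pM; rewrite ?powR_ge0 //; [lra|lra|].
  exact: powR_dist_le.
apply: (le_trans (normcB_le _ _)); apply: (@le_trans _ _ (N * 1)).
  by have := fM x; have := fM y; lra.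
rewrite ler_wpM2l //; first lra.
by rewrite -(powRr0 `|x - y|) ler_powR // ltW.
Qed.

Lemma bholder_common f g : bholder f -> bholder g ->
  exists a M, bholder_with a M f /\ bholder_with a M g.
Proof.
move=> [a [M Hf]] [b [N Hg]].
have [a0 _ M1 _ _] := Hf; have [b0 _ N1 _ _] := Hg.
exists (Num.min a b), (2 * (M + N)); split.
  apply: (bholder_with_weaken _ _ _ Hf); rewrite ?lt_min ?a0 ?ge_min ?lexx //; lra.
apply: (bholder_with_weaken _ _ _ Hg); rewrite ?lt_min ?a0 ?ge_min ?lexx ?orbT //; lra.
Qed.

(** The common source of closure under sums, products, inverses and exponentials: only boundedness
    and a Lipschitz dependence on the arguments have to be checked. *)
Lemma bholder_lip2 f g h (C : R) : bholder f -> bholder g ->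
  (forall x, normc (h x) <= C) ->
  (forall x y, normc (h x - h y) <= C * (normc (f x - f y) + normc (g x - g y))) ->
  bholder h.
Proof.
move=> hf hg hC hl.
have [a [M [[a0 a1 M1 fM Hf] [_ _ _ gM Hg]]]] := bholder_common hf hg.
have C0 : 0 <= C := le_trans (normc_ge0 _) (hC 0).
have CM : 0 <= C * M by rewrite mulr_ge0 //; lra.
exists a, (C + 2 * (C * M) + 1); split => //; first lra.
  by move=> x; apply: (le_trans (hC x)); lra.
move=> x y; apply: (le_trans (hl x y)).
have p0 := powR_ge0 `|x - y| a.
apply: (@le_trans _ _ (2 * (C * M) * `|x - y| `^ a)).
  rewrite -!mulrA [2 * _]mulrC -mulrA ler_wpM2l //.
  by have := Hf x y; have := Hg x y; lra.
by rewrite ler_wpM2r //; lra.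
Qed.

Lemma bholder_lip f h (C : R) : bholder f ->
  (forall x, normc (h x) <= C) ->
  (forall x y, normc (h x - h y) <= C * normc (f x - f y)) -> bholder h.
Proof.
move=> hf hC hl; have C0 : 0 <= C := le_trans (normc_ge0 _) (hC 0).
apply: (bholder_lip2 hf hf hC) => x y; apply: (le_trans (hl x y)).
by rewrite ler_wpM2l // lerDl normc_ge0.
Qed.

Lemma bholder_ext f g : f =1 g -> bholder f -> bholder g.
Proof. by move/funext ->. Qed.

Lemma bholder_bounded f : bholder f -> exists2 M : R, 0 < M & forall x, normc (f x) <= M.
Proof. by move=> [a [M [_ _ M1 H _]]]; exists M => //; lra. Qed.

Lemma bholder_cst c : bholder (fun=> c).
Proof.
exists 1, (1 + normc c); split => //; rewrite ?lerDl ?normc_ge0 // => x.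
  by rewrite lerDr.
by move=> y; rewrite subrr normc0 mulr_ge0 ?powR_ge0 ?addr_ge0 ?normc_ge0.
Qed.

Lemma bholderD f g : bholder f -> bholder g -> bholder (fun x => f x + g x).
Proof.
move=> hf hg; have [a [M [[a0 a1 M1 fM Hf] [_ _ _ gM Hg]]]] := bholder_common hf hg.
apply: (@bholder_lip2 f g _ (2 * M)) => // x.
  by apply: (le_trans (normcD_le _ _)); have := fM x; have := gM x; lra.
move=> y; rewrite opprD addrACA; apply: (le_trans (normcD_le _ _)).
have := normc_ge0 (f x - f y); have := normc_ge0 (g x - g y); nra.
Qed.

Lemma bholderM f g : bholder f -> bholder g -> bholder (fun x => f x * g x).
Proof.
move=> hf hg; have [a [M [[a0 a1 M1 fM Hf] [_ _ _ gM Hg]]]] := bholder_common hf hg.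
apply: (@bholder_lip2 f g _ (M * M)) => // x.
  by rewrite normcM ler_pM ?normc_ge0.
move=> y; have -> : f x * g x - f y * g y = f x * (g x - g y) + (f x - f y) * g y.
  by ring.
apply: (le_trans (normcD_le _ _)); rewrite !normcM.
have := normc_ge0 (f x - f y); have := normc_ge0 (g x - g y).
have := fM x; have := gM y; have := normc_ge0 (f x); have := normc_ge0 (g y).
set p := normc (f x); set q := normc (g y); set r := normc (f x - f y).
set s := normc (g x - g y) => q0 p0 qM pM s0 r0.
have h1 : p * s <= M * M * s by rewrite ler_wpM2r //; nra.
have h2 : r * q <= M * M * r by rewrite mulrC ler_wpM2r //; nra.
lra.
Qed.

Lemma bholderZ c f : bholder f -> bholder (fun x => c * f x).
Proof. by move=> hf; apply: bholderM => //; exact: bholder_cst. Qed.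

Lemma bholderN f : bholder f -> bholder (fun x => - f x).
Proof.
by move=> hf; apply: bholder_ext (bholderZ (-1) hf) => x; rewrite mulN1r.
Qed.

Lemma bholderB f g : bholder f -> bholder g -> bholder (fun x => f x - g x).
Proof. by move=> hf hg; apply: bholderD => //; exact: bholderN. Qed.

Lemma bholderV f (c : R) : 0 < c -> (forall x, c <= normc (f x)) ->
  bholder f -> bholder (fun x => (f x)^-1).
Proof.
move=> c0 fc hf; apply: (@bholder_lip f _ (c^-1 + c^-1 * c^-1)) => // x.
  rewrite normcV; apply: (@le_trans _ _ c^-1); last by rewrite lerDl mulr_ge0 ?invr_ge0 ?ltW.
  by rewrite lef_pV2 ?posrE // (lt_le_trans c0).
move=> y; have nz z : f z != 0.
  by apply/eqP => h; have := fc z; rewrite h normc0 leNgt c0.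
have -> : (f x)^-1 - (f y)^-1 = (f y - f x) * ((f x)^-1 * (f y)^-1).
  by field; rewrite !nz.
rewrite !normcM !normcV normcBC mulrC ler_wpM2r ?normc_ge0 //.
apply: (@le_trans _ _ (c^-1 * c^-1)); last by rewrite lerDr invr_ge0 ltW.
by apply: ler_pM; rewrite ?invr_ge0 ?normc_ge0 // lef_pV2 ?posrE // (lt_le_trans c0).
Qed.

Lemma bholder_cexp f : bholder f -> bholder (fun x => cexp (f x)).
Proof.
move=> hf; have [M M0 fM] := bholder_bounded hf.
apply: (bholder_lip (C := 4 * expR M) hf) => x.
  rewrite normc_cexp; have h : expR (complex.Re (f x)) <= expR M.
    by rewrite ler_expR (le_trans (ler_norm _)) // (le_trans (normRe_le _)).
  by have := expR_gt0 M; lra.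
by move=> y; exact: cexp_lip.
Qed.

Lemma bholder_ReIm (u v : R -> R) : bholder (fun x => (u x)%:C) ->
  bholder (fun x => (v x)%:C) -> bholder (fun x => u x +i* v x).
Proof.
move=> hu hv; apply: bholder_ext (bholderD hu (bholderZ 'i hv)) => x.
by rewrite [RHS]complexE.
Qed.

Lemma bholder_real (u : R -> R) (a C D : R) : 0 < a -> a <= 1 ->
  (forall x, `|u x| <= C) ->
  (forall x y, `|u x - u y| <= D * `|x - y| `^ a) -> bholder (fun x => (u x)%:C).
Proof.
move=> a0 a1 uC uD; exists a, (1 + `|C| + `|D|); split => //.
- by rewrite -addrA lerDl addr_ge0.
- move=> x; rewrite normcR (le_trans (uC x)) // (le_trans (ler_norm C)) //.
  by have := normr_ge0 D; lra.
- move=> x y; rewrite -rmorphB normcR (le_trans (uD x y)) // ler_wpM2r ?powR_ge0 //.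
  by have := normr_ge0 C; have := ler_norm D; lra.
Qed.

Lemma bholder_real_lip (u : R -> R) (C D : R) :
  (forall x, `|u x| <= C) -> (forall x y, `|u x - u y| <= D * `|x - y|) ->
  bholder (fun x => (u x)%:C).
Proof.
move=> uC uD; apply: (@bholder_real u 1 C D) => // x y.
by rewrite powRr1.
Qed.

Definition csquare_integrable f := square_integrable (@complex.Re R \o f) /\
  square_integrable (@complex.Im R \o f).

Definition chilb f (v : R) : R[i] :=
  hilb (@complex.Re R \o f) v +i* hilb (@complex.Im R \o f) v.

Lemma bholder_with_Re a M f : bholder_with a M f -> holder_bound a M (@complex.Re R \o f).
Proof. by case=> _ _ _ _ H x y; rewrite /= -complex_ReB (le_trans (normRe_le _)). Qed.

Lemma bholder_with_Im a M f : bholder_with a M f -> holder_bound a M (@complex.Im R \o f).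
Proof. by case=> _ _ _ _ H x y; rewrite /= -complex_ImB (le_trans (normIm_le _)). Qed.

(** The kernel is real, so real and imaginary parts separate; as the truncated integrals converge by
    [pv_hilb], each [lim] is a genuine limit. *)
Lemma pv_integral_chilb f v : bholder f -> csquare_integrable f ->
  pv_integral v (fun w => f w / (w - v)%:C) = chilb f v.
Proof.
move=> [a [M Hf]] [s1 s2]; have [a0 a1 M1 _ _] := Hf.
rewrite /pv_integral /clim /cintegral /chilb /=.
congr (_ +i* _).
  under [X in lim (X x @[x --> _])]eq_fun do under eq_Rintegral do rewrite Re_divR.
  by apply: cvg_lim => //; apply: (pv_hilb a0 a1 M1 (bholder_with_Re Hf) s1).
under [X in lim (X x @[x --> _])]eq_fun do under eq_Rintegral do rewrite Im_divR.
by apply: cvg_lim => //; apply: (pv_hilb a0 a1 M1 (bholder_with_Im Hf) s2).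
Qed.

Lemma bholder_hilb (u : R -> R) a M : 0 < a -> a <= 1 -> 1 <= M ->
  holder_bound a M u -> square_integrable u -> bholder (fun v => (hilb u v)%:C).
Proof.
move=> a0 a1 M1 Hu su.
apply: (@bholder_real _ (a / 2) _ _ _ _ (hilb_le a0 a1 M1 Hu su) (hilb_holder a0 a1 M1 Hu su)).
  by rewrite divr_gt0.
lra.
Qed.

Lemma bholder_chilb f : bholder f -> csquare_integrable f -> bholder (chilb f).
Proof.
move=> [a [M Hf]] [s1 s2]; have [a0 a1 M1 _ _] := Hf.
apply: bholder_ReIm.
  exact: (bholder_hilb a0 a1 M1 (bholder_with_Re Hf) s1).
exact: (bholder_hilb a0 a1 M1 (bholder_with_Im Hf) s2).
Qed.

Lemma bholder_measurable f : bholder f ->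
  measurable_fun setT (@complex.Re R \o f) /\ measurable_fun setT (@complex.Im R \o f).
Proof.
move=> [a [M Hf]]; have [a0 a1 M1 _ _] := Hf.
split; first exact: (measurable_holder a0 (bholder_with_Re Hf)).
exact: (measurable_holder a0 (bholder_with_Im Hf)).
Qed.

Definition decays f := exists C : R, forall x, normc (f x) <= C / (1 + `|x|).

(** [kap 1 x] is exactly (1 + |x|)^(-2), so C^2 times it is a majorant. *)
Lemma decays_square (u : R -> R) (C : R) : measurable_fun setT u ->
  (forall x, `|u x| <= C / (1 + `|x|)) -> square_integrable u.
Proof.
move=> mu' uC.
apply: (integrable_domin _ (integrable_mull (C ^+ 2) (kap_integrable (@ltr01 R)))).
  exact: measurable_funX.
move=> x; rewrite /kap subrr powRr0 powRr1 // mul1r ger0_norm ?sqr_ge0 //.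
rewrite -exprVn -exprMn -(@real_normK _ (u x)) ?num_real //.
by rewrite lerXn2r ?nnegrE // (le_trans _ (uC x)).
Qed.

Lemma decays_csquare f : bholder f -> decays f -> csquare_integrable f.
Proof.
move=> /bholder_measurable[m1 m2] [C fC]; split.
  by apply: (@decays_square _ C) => // x; rewrite (le_trans (normRe_le _)).
by apply: (@decays_square _ C) => // x; rewrite (le_trans (normIm_le _)).
Qed.

Lemma integrable_square (u : R -> R) (C : R) : measurable_fun setT u ->
  (forall x, `|u x| <= C) -> mu.-integrable setT (EFin \o u) -> square_integrable u.
Proof.
move=> mu' uC iu.
have iu' : mu.-integrable setT (EFin \o (fun x => `|u x|)) by exact: integrable_norm.
apply: (integrable_domin _ (integrable_mull C iu')).
  exact: measurable_funX.
by move=> x; rewrite normrX expr2 ler_wpM2r.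
Qed.

Lemma cintegrable_csquare f : bholder f -> cintegrable setT f -> csquare_integrable f.
Proof.
move=> hf [i1 i2]; have [m1 m2] := bholder_measurable hf.
have [M M0 fM] := bholder_bounded hf; split.
  by apply: (@integrable_square _ M) => // x; rewrite (le_trans (normRe_le _)).
by apply: (@integrable_square _ M) => // x; rewrite (le_trans (normIm_le _)).
Qed.

Lemma cintegrableM f g : bholder f -> cintegrable setT g ->
  cintegrable setT (fun x => f x * g x).
Proof.
move=> hf [i1 i2]; have [m1 m2] := bholder_measurable hf.
have [M M0 fM] := bholder_bounded hf.
have n1 : measurable_fun setT (@complex.Re R \o g).
  by apply/measurable_EFinP; exact: measurable_int i1.
have n2 : measurable_fun setT (@complex.Im R \o g).
  by apply/measurable_EFinP; exact: measurable_int i2.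
have j1 : mu.-integrable setT (EFin \o (fun x => `|complex.Re (g x)|)) by exact: integrable_norm.
have j2 : mu.-integrable setT (EFin \o (fun x => `|complex.Im (g x)|)) by exact: integrable_norm.
have j := integrable_mull M (integrable_addr j1 j2).
have hr x := le_trans (normRe_le _) (fM x).
have hi x := le_trans (normIm_le _) (fM x).
split; apply: (integrable_domin _ j).
- under eq_fun do rewrite complex_ReM.
  by apply: measurable_funB; apply: measurable_funM.
- move=> x; rewrite complex_ReM mulrDr (le_trans (ler_normB _ _)) // !normrM.
  by apply: lerD; rewrite ler_wpM2r.
- under eq_fun do rewrite complex_ImM.
  by apply: measurable_funD; apply: measurable_funM.
- move=> x; rewrite complex_ImM mulrDr addrC (le_trans (ler_normD _ _)) // !normrM.
  by apply: lerD; rewrite ler_wpM2r.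
Qed.

Lemma cintegrableD f g : cintegrable setT f -> cintegrable setT g ->
  cintegrable setT (fun x => f x + g x).
Proof.
move=> [f1 f2] [g1 g2]; split.
  have := integrable_addr f1 g1; apply: eq_integrable => // x _ /=.
  by case: (f x) (g x) => [? ?] [].
have := integrable_addr f2 g2; apply: eq_integrable => // x _ /=.
by case: (f x) (g x) => [? ?] [].
Qed.

End BoundedHolder.

(** * Dawson's function and the symbol *)

Section Symbol.
Variable R : realType.
Notation mu := (@lebesgue_measure R).
Implicit Types v x y xi : R.

Definition gauss v := expR (- v ^+ 2).

Lemma gauss_gt0 v : 0 < gauss v. Proof. exact: expR_gt0. Qed.

Lemma gauss_le v : gauss v <= (1 + v ^+ 2)^-1.
Proof.
rewrite /gauss expRN lef_pV2 ?posrE ?expR_gt0 ?expR_ge1Dx //.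
by rewrite ltr_pwDl // sqr_ge0.
Qed.

Lemma gauss_le1 v : gauss v <= 1.
Proof. by rewrite /gauss -expR0 ler_expR oppr_le0 sqr_ge0. Qed.

Lemma gauss_ge v : 1 - v ^+ 2 <= gauss v.
Proof. exact: expR_ge1Dx. Qed.

(** The derivative is at most 2 |v| / (1 + v^2) <= 1 in absolute value. *)
Lemma gauss_lip x y : `|gauss x - gauss y| <= `|x - y|.
Proof.
apply: (@lip_derive _ gauss (fun v => gauss v * (- (2 * v)))) => v.
  rewrite /gauss; apply: is_derive_eq.
  rewrite /GRing.scale /=; ring.
rewrite normrM normrN normrM (@ger0_norm _ 2) // (gtr0_norm (gauss_gt0 v)).
have h := gauss_le v; have v0 := normr_ge0 v.
apply: (@le_trans _ _ ((1 + v ^+ 2)^-1 * (2 * `|v|))).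
  by rewrite ler_wpM2r // mulr_ge0.
rewrite mulrC ler_pdivrMr ?mul1r ?ltr_pwDl ?sqr_ge0 //.
rewrite -(@real_normK _ v) ?num_real //; have := sqr_ge0 (1 - `|v|); nra.
Qed.

Lemma gauss_decay v : gauss v <= 2 / (1 + `|v|).
Proof.
apply: (le_trans (gauss_le v)).
have v0 := normr_ge0 v.
rewrite ler_pdivlMr; last by lra.
rewrite mulrC ler_pdivrMr; last by rewrite ltr_pwDl // sqr_ge0.
rewrite -(@real_normK _ v) ?num_real //; have := sqr_ge0 (1 - `|v|); nra.
Qed.

Lemma sqrt_pi_gt1 : 1 < Num.sqrt pi :> R.
Proof.
rewrite -[ltLHS]sqrtr1 ltr_sqrt ?pi_gt0 //.
by have := @pi_ge2 R; lra.
Qed.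

Lemma sqrt_piK : Num.sqrt pi * Num.sqrt pi = pi :> R.
Proof. by rewrite -expr2 sqr_sqrtr // pi_ge0. Qed.

Lemma phiE v : phi v = gauss v / Num.sqrt pi. Proof. by []. Qed.

Lemma phi_gt0 v : 0 < phi v.
Proof. by rewrite phiE divr_gt0 ?gauss_gt0 // (lt_trans ltr01) // sqrt_pi_gt1. Qed.

Lemma pi_phi v : pi * phi v = Num.sqrt pi * gauss v.
Proof.
have s0 : Num.sqrt pi != 0 :> R by rewrite gt_eqF // (lt_trans ltr01) // sqrt_pi_gt1.
by rewrite phiE -{1}sqrt_piK; field.
Qed.

Lemma integrable_phi : mu.-integrable setT (EFin \o @phi R).
Proof.
have := integrable_mull ((Num.sqrt pi)^-1) (@integrableT_gauss R).
by apply: eq_integrable => // x _ /=; rewrite mulrC.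
Qed.

Lemma integral_phi : \int[mu]_x phi x = 1.
Proof.
rewrite (_ : @phi R = fun x => (Num.sqrt pi)^-1 * gauss_fun x); last first.
  by apply/funext => x; rewrite mulrC.
rewrite RintegralZl //; last exact: integrableT_gauss.
rewrite /Rintegral integralT_gauss /= mulVf // gt_eqF //.
exact: lt_trans ltr01 sqrt_pi_gt1.
Qed.

Lemma bholder_gauss : bholder (fun v => (gauss v)%:C).
Proof.
apply: (@bholder_real_lip _ _ 1 1) => [v|x y].
  by rewrite gtr0_norm ?gauss_gt0 // gauss_le1.
by rewrite mul1r gauss_lip.
Qed.

Lemma bholder_phi : bholder (fun v => (phi v)%:C).
Proof.
apply: bholder_ext (bholderZ ((Num.sqrt pi)^-1)%:C bholder_gauss) => v.
by rewrite -rmorphM mulrC.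
Qed.

Lemma bholder_B : bholder (@B_ R).
Proof.
apply: bholder_ext (bholderZ (- pi)%:C bholder_phi) => v.
by rewrite -rmorphM mulNr.
Qed.

(** The imaginary error function without its factor 2 / sqrt pi. It is meant for y >= 0: the
    interval is empty otherwise. *)
Definition erfi y := \int[mu]_(x in `[0, y]) expR (x ^+ 2).

Lemma continuous_expsq : continuous (fun x : R => expR (x ^+ 2)).
Proof. by move=> x; apply: continuous_comp; [exact: exprn_continuous|exact: continuous_expR]. Qed.

Lemma integrable_itv (f : R -> R) x y : continuous f ->
  mu.-integrable (`[x, y]%classic : set R) (EFin \o f).
Proof.
move=> cf; apply: continuous_compact_integrable; first exact: segment_compact.
by apply: continuous_subspaceT.
Qed.

Lemma Rintegral_itv_cst x y (c : R) : x <= y -> \int[mu]_(_ in `[x, y]) c = c * (y - x).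
Proof.
move=> xy; rewrite Rintegral_cst //= lebesgue_measure_itv /= lte_fin.
by move: xy; rewrite le_eqVlt => /predU1P[->|->]; rewrite ?ltxx ?subrr -?EFinB.
Qed.

Lemma le_Rintegral_itv (f g : R -> R) x y : continuous f -> continuous g ->
  (forall z, x <= z -> z <= y -> f z <= g z) ->
  \int[mu]_(z in `[x, y]) f z <= \int[mu]_(z in `[x, y]) g z.
Proof.
move=> cf cg fg; apply: le_Rintegral => //; try exact: integrable_itv.
by move=> z; rewrite /= in_itv /= => /andP[]; exact: fg.
Qed.

Lemma erfi_ge y : 0 <= y -> y <= erfi y.
Proof.
move=> y0; rewrite -[leLHS](mul1r y) -{1}(subr0 y) -Rintegral_itv_cst //.
apply: le_Rintegral_itv; [by move=> ?; exact: cst_continuous|exact: continuous_expsq|].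
by move=> z _ _; rewrite -expR0 ler_expR sqr_ge0.
Qed.

Lemma erfi_le y : 0 <= y -> erfi y <= expR (y ^+ 2) * y.
Proof.
move=> y0; rewrite -{3}(subr0 y) -Rintegral_itv_cst //.
apply: le_Rintegral_itv; [exact: continuous_expsq|by move=> ?; exact: cst_continuous|].
by move=> z z0 zy; rewrite ler_expR lerXn2r ?nnegrE // (le_trans z0).
Qed.

Lemma erfi_growth x y : 0 <= x -> x <= y ->
  0 <= erfi y - erfi x <= expR (y ^+ 2) * (y - x).
Proof.
move=> x0 xy.
have e : erfi y - erfi x = \int[mu]_(z in `[x, y]) expR (z ^+ 2).
  rewrite /erfi Rintegral_itvB ?bnd_simp //; last exact: (integrable_itv _ _ continuous_expsq).
  rewrite Rintegral_itv_obnd_cbnd //.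
  apply: integrableS (integrable_itv x y continuous_expsq) => //.
  by move=> z /=; rewrite !in_itv /= => /andP[/ltW -> ->].
rewrite e; apply/andP; split.
  by apply: Rintegral_ge0 => z _; exact: expR_ge0.
rewrite -Rintegral_itv_cst //.
apply: le_Rintegral_itv; [exact: continuous_expsq|by move=> ?; exact: cst_continuous|].
move=> z xz zy; rewrite ler_expR lerXn2r ?nnegrE // (le_trans x0) // (le_trans xz).
Qed.

(** On [0, y] one has x^2 <= y x, and e^(y x) has an explicit primitive. This yields the decay of
    Dawson's function like 1/y. *)
Lemma erfi_mul y : 0 < y -> y * erfi y <= expR (y ^+ 2).
Proof.
move=> y0.
have cE : continuous (fun x : R => expR (y * x)).
  by move=> x; apply: continuous_comp; [exact: mulrl_continuous|exact: continuous_expR].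
have h : erfi y <= \int[mu]_(x in `[0, y]) expR (y * x).
  apply: le_Rintegral_itv => //; first exact: continuous_expsq.
  by move=> z z0 zy; rewrite ler_expR expr2 ler_wpM2r.
have dE (x : R) : is_derive x 1 (fun x => y^-1 * expR (y * x)) (expR (y * x)).
  apply: is_derive_eq; rewrite /GRing.scale /=.
  by field; rewrite gt_eqF.
have cF : continuous (fun x : R => y^-1 * expR (y * x)).
  by move=> x; have [/derivable1_diffP/differentiable_continuous ] := dE x.
have e : \int[mu]_(x in `[0, y]) expR (y * x) = y^-1 * expR (y ^+ 2) - y^-1.
  rewrite /Rintegral (@continuous_FTC2 R _ (fun x => y^-1 * expR (y * x))) //.
  - by rewrite -EFinB /= mulr0 expR0 mulr1 expr2.
  - exact: continuous_subspaceT.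
  - split; [by move=> x _; case: (dE x)| |].
    + exact/cvg_at_right_filter/cF.
    + exact/cvg_at_left_filter/cF.
  - by move=> x _; rewrite derive1E; have /= := @derive_val _ _ _ _ _ _ _ (dE x).
rewrite e in h.
have h2 : y * erfi y <= y * (y^-1 * expR (y ^+ 2) - y^-1) by rewrite ler_pM2l.
apply: (le_trans h2); rewrite mulrBr mulrA mulfV ?gt_eqF // mul1r.
by rewrite gerDl oppr_le0.
Qed.

End Symbol.

(** * Bounds on Dawson's function and lower bounds on A + B and A - B *)

Section SymbolBounds.
Variable R : realType.
Notation mu := (@lebesgue_measure R).
Implicit Types v x y xi : R.

Lemma dawson_ge0E y : 0 <= y -> dawson y = gauss y * erfi y.
Proof. by rewrite /dawson => ->. Qed.

Lemma dawsonN y : dawson (- y) = - dawson y.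
Proof.
have aux (z : R) : 0 < z -> dawson (- z) = - dawson z.
  move=> z0; rewrite (dawson_ge0E (ltW z0)) /dawson leNgt oppr_lt0 z0 /= sqrrN mulrN.
  congr (- (_ * _)); rewrite /erfi [LHS]Rintegral_mkcond [RHS]Rintegral_mkcond.
  have i1 : mu.-integrable setT (EFin \o ((fun x => expR (x ^+ 2)) \_ (`[0, z]%classic : set R))).
    have [+ _] := @integrable_mkcond _ _ R mu (`[0, z]%classic : set R)
      (EFin \o (fun x => expR (x ^+ 2))) (measurable_itv _).
    rewrite restrict_EFin; apply; exact: (integrable_itv _ _ (@continuous_expsq R)).
  have [_ e] := integrable_preserves (preserves_subl 0) i1.
  apply: etrans e; apply: eq_Rintegral => x _; rewrite !patchE sub0r sqrrN.
  congr (if _ then _ else _).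
  by apply/idP/idP; rewrite !inE /= !in_itv /= => /andP[? ?]; apply/andP; split; lra.
have [y0|y0|->] := ltgtP y 0.
- by have := aux (- y); rewrite opprK oppr_gt0 => /(_ y0) ->; rewrite opprK.
- exact: aux.
- by rewrite oppr0 dawson_ge0E // /erfi set_itv1 Rintegral_set1 mulr0 oppr0.
Qed.

Lemma gauss_expR y : gauss y * expR (y ^+ 2) = 1.
Proof. by rewrite /gauss -expRD addNr expR0. Qed.

Lemma dawson_le y : 0 <= y -> dawson y <= y.
Proof.
move=> y0; rewrite dawson_ge0E // -[leRHS]mul1r -(gauss_expR y) -mulrA.
by rewrite ler_wpM2l ?(ltW (gauss_gt0 y)) // erfi_le.
Qed.

Lemma dawson_ge y : 0 <= y -> gauss y * y <= dawson y.
Proof.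
by move=> y0; rewrite dawson_ge0E // ler_wpM2l ?(ltW (gauss_gt0 y)) // erfi_ge.
Qed.

Lemma dawson_ge0 y : 0 <= y -> 0 <= dawson y.
Proof. by move=> y0; apply: le_trans (dawson_ge y0); rewrite mulr_ge0 // ltW ?gauss_gt0. Qed.

Lemma dawson_mul y : 0 <= y -> y * dawson y <= 1.
Proof.
rewrite le_eqVlt => /predU1P[<-|y0]; first by rewrite mul0r.
rewrite dawson_ge0E ?(ltW y0) // mulrCA -(gauss_expR y).
by rewrite ler_wpM2l ?(ltW (gauss_gt0 y)) // erfi_mul.
Qed.

Lemma dawson_le1 y : 0 <= y -> dawson y <= 1.
Proof.
move=> y0; have [y1|/ltW y1] := leP y 1; first exact: le_trans (dawson_le y0) y1.
have := dawson_mul y0; have := dawson_ge0 y0; nra.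
Qed.

Lemma dawson_norm y : `|dawson y| = dawson `|y|.
Proof.
have [y0|y0] := leP 0 y; first by rewrite !ger0_norm ?dawson_ge0.
have e : dawson y = - dawson (- y) by rewrite -dawsonN opprK.
rewrite e normrN ger0_norm; last by rewrite dawson_ge0 // oppr_ge0 ltW.
by rewrite ltr0_norm.
Qed.

(** For 0 <= a <= b, D(a) - D(b) is the loss of the Gaussian times [erfi a], minus the Gaussian at b
    times the gain of [erfi]. Both terms are nonnegative; they are at most 3 (b - a) and b - a when
    b - a <= 1, and for longer steps 0 <= D <= 1 suffices. Oddness reduces the other signs to this
    case or to D(y) <= y. *)
Lemma dawson_lip x y : `|dawson x - dawson y| <= 4 * `|x - y|.
Proof.
have pos (a b : R) : 0 <= a -> a <= b -> `|dawson a - dawson b| <= 4 * `|a - b|.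
  move=> a0 ab; have b0 := le_trans a0 ab.
  have da := dawson_ge0 a0; have db := dawson_ge0 b0.
  have da1 := dawson_le1 a0; have db1 := dawson_le1 b0.
  rewrite [X in _ <= 4 * X]ler0_norm ?subr_le0 // opprB ler_norml.
  have [h|/ltW h] := leP 1 (b - a); first by apply/andP; split; lra.
  have /andP[g0 g1] := erfi_growth a0 ab.
  have ga := gauss_gt0 a; have gb := gauss_gt0 b.
  have e : dawson a - dawson b = (gauss a - gauss b) * erfi a - gauss b * (erfi b - erfi a).
    by rewrite !dawson_ge0E //; ring.
  have k1 : gauss b * (erfi b - erfi a) <= b - a.
    rewrite -[leRHS]mul1r -(gauss_expR b) -mulrA ler_wpM2l //; exact: ltW.
  have k2 : 0 <= gauss b * (erfi b - erfi a) by rewrite mulr_ge0 // ltW.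
  have gab : gauss b <= gauss a.
    by rewrite /gauss ler_expR lerN2 lerXn2r ?nnegrE.
  have erfa : 0 <= erfi a := le_trans a0 (erfi_ge a0).
  have k3 : 0 <= (gauss a - gauss b) * erfi a by rewrite mulr_ge0 // subr_ge0.
  have k4 : (gauss a - gauss b) * erfi a <= 3 * (b - a).
    have e2 : gauss b = gauss a * expR (a ^+ 2 - b ^+ 2).
      by rewrite /gauss -expRD; congr expR; ring.
    have e3 : gauss a - gauss b <= gauss a * ((b - a) * (b + a)).
      rewrite e2 -[X in X - _]mulr1 -mulrBr ler_wpM2l ?(ltW ga) //.
      have := expR_ge1Dx (a ^+ 2 - b ^+ 2).
      have -> : (b - a) * (b + a) = b ^+ 2 - a ^+ 2 by ring.
      lra.
    apply: (@le_trans _ _ (gauss a * ((b - a) * (b + a)) * erfi a)).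
      by rewrite ler_wpM2r.
    have -> : gauss a * ((b - a) * (b + a)) * erfi a = (b - a) * ((b + a) * dawson a).
      by rewrite dawson_ge0E //; ring.
    rewrite mulrC ler_wpM2r ?subr_ge0 //.
    (* (b + a) D(a) = 2 a D(a) + (b - a) D(a) <= 2 + 1. *)
    have := dawson_mul a0; nra.
  by apply/andP; split; rewrite e; lra.
have pos' (a b : R) : 0 <= a -> 0 <= b -> `|dawson a - dawson b| <= 4 * `|a - b|.
  move=> a0 b0; have [ab|/ltW ab] := leP a b; first exact: pos.
  by rewrite distrC (distrC a); exact: pos.
have mix (a b : R) : 0 <= a -> b <= 0 -> `|dawson a - dawson b| <= 4 * `|a - b|.
  move=> a0 b0; have nb : 0 <= - b by rewrite oppr_ge0.
  have e : dawson b = - dawson (- b) by rewrite -dawsonN opprK.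
  rewrite e opprK ger0_norm ?addr_ge0 ?dawson_ge0 //.
  rewrite ger0_norm; last by lra.
  by have := dawson_le a0; have := dawson_le nb; lra.
have [x0|/ltW x0] := leP 0 x; have [y0|/ltW y0] := leP 0 y.
- exact: pos'.
- exact: mix.
- by rewrite distrC (distrC x); exact: mix.
- have h : `|dawson (- x) - dawson (- y)| <= 4 * `|- x - - y|.
    by apply: pos'; rewrite oppr_ge0.
  rewrite !dawsonN in h; move: h.
  have -> : - dawson x - - dawson y = - (dawson x - dawson y) by ring.
  have -> : - x - - y = - (x - y) by ring.
  by rewrite !normrN.
Qed.

Lemma bholder_A xi : bholder (A_ xi).
Proof.
apply: bholderB; first exact: bholder_cst.
apply: bholderZ; apply: (@bholder_real_lip _ _ 1 4); last exact: dawson_lip.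
by move=> x; rewrite dawson_norm dawson_le1.
Qed.

(** The sign [s] lets A + B and A - B be treated at once. *)
Lemma A_comp xi v (s : R) : s = 1 \/ s = -1 ->
  complex.Re (A_ xi v + s%:C * B_ v) = xi - s * (Num.sqrt pi * gauss v) /\
  complex.Im (A_ xi v + s%:C * B_ v) = - 2 * dawson v.
Proof.
move=> _; rewrite /A_ /B_ pi_phi /=; split; simpc => /=; ring.
Qed.

(* With r = |xi| / sqrt pi: where e^(-v^2) is far from r the real part is large,
   elsewhere v stays away from 0 and the Dawson function is large. *)
Lemma symbol_lower_bound xi : xi != 0 -> `|xi| < Num.sqrt pi ->
  exists2 c : R, 0 < c & forall (s v : R), s = 1 \/ s = -1 ->
    c <= normc (A_ xi v + s%:C * B_ v).
Proof.
move=> xi0 xipi; have s1 := @sqrt_pi_gt1 R; set sp := Num.sqrt pi in s1 xipi *.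
have sp0 : 0 < sp by exact: lt_trans s1.
pose r := `|xi| / sp.
have r0 : 0 < r by rewrite divr_gt0 // normr_gt0.
have r1 : r < 1 by rewrite ltr_pdivrMr // mul1r.
have xir : `|xi| = r * sp by rewrite divfK // gt_eqF.
(* This is what the middle range r/2 < e^(-v^2) < (1 + r)/2 yields: there |v| >= (1 - r)/2 and 2
   D(|v|) >= 2 e^(-v^2) |v|. The two outer ranges give at least as much. *)
exists (r * (1 - r) / 2); first by rewrite divr_gt0 // mulr_gt0 // subr_gt0.
move=> s v hs; have [eR eI] := A_comp xi v hs.
have g0 := gauss_gt0 v; set p := gauss v in g0 *.
have hre : sp * `|r - p| <= normc (A_ xi v + s%:C * B_ v).
  apply: le_trans (normRe_le _); rewrite eR -/sp -/p.
  have -> : sp * `|r - p| = `| `|xi| - sp * p|.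
    by rewrite -{1}(gtr0_norm sp0) -normrM xir; congr `|_|; ring.
  have spp : 0 < sp * p by exact: mulr_gt0.
  have e : `|s * (sp * p)| = sp * p.
    by rewrite normrM (gtr0_norm spp); case: hs => ->; rewrite ?normrN normr1 mul1r.
  rewrite -{1}e; exact: ler_dist_dist.
have him : 2 * dawson `|v| <= normc (A_ xi v + s%:C * B_ v).
  apply: le_trans (normIm_le _); rewrite eI normrM normrN.
  by rewrite (@ger0_norm _ 2) // dawson_norm.
have [h|h] := leP p (r / 2).
  apply: (le_trans _ hre); rewrite ger0_norm; last by lra.
  by nra.
have [h'|h'] := leP ((1 + r) / 2) p.
  apply: (le_trans _ hre); rewrite ler0_norm; last by lra.
  by nra.
apply: (le_trans _ him).
have hv : (1 - r) / 2 <= `|v|.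
  rewrite leNgt; apply/negP => hv.
  have := gauss_ge v; rewrite -/p -(@real_normK _ v) ?num_real // => h2.
  by have := normr_ge0 v; nra.
have := dawson_ge (normr_ge0 v).
have -> : gauss `|v| = p by rewrite /p /gauss real_normK ?num_real.
by nra.
Qed.

End SymbolBounds.

(** * Logarithm of the symbol *)

Section LogBranch.
Variable R : realType.
Implicit Types (f g : R -> R[i]) (v x y : R).

Lemma ln_lip (m x y : R) : 0 < m -> m <= x -> m <= y ->
  `|ln x - ln y| <= `|x - y| / m.
Proof.
move=> m0; wlog xy : x y / y <= x => [h mx my|mx my].
  by have [xy|/ltW xy] := leP y x; [exact: h|rewrite distrC (distrC x); exact: h].
have y0 : 0 < y by exact: lt_le_trans my.
have x0 : 0 < x by exact: lt_le_trans mx.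
rewrite !ger0_norm ?subr_ge0 ?ler_ln ?posrE //.
rewrite -ln_div ?posrE //.
have -> : x / y = 1 + (x - y) / y by field; rewrite gt_eqF.
apply: (le_trans (le_ln1Dx _)).
  by apply: (@lt_le_trans _ _ 0); [lra|rewrite divr_ge0 ?subr_ge0 // ltW].
by rewrite ler_wpM2l ?subr_ge0 // lef_pV2.
Qed.

(** By the mean value theorem: on [0, 1/2] the cosine is at least 1/2, being 1 at 0 and
    1-Lipschitz. *)
Lemma sin_lower x : `|x| <= 2^-1 -> `|x| <= 2 * `|sin x|.
Proof.
suff h y : 0 <= y -> y <= 2^-1 -> y <= 2 * `|sin y|.
  have [x0|/ltW x0] := leP 0 x; first by rewrite {1 2}(ger0_norm x0); exact: h.
  by rewrite -normrN -[`|sin x|]normrN -sinN {1 2}ger0_norm ?oppr_ge0 //; apply: h; rewrite oppr_ge0.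
move=> y0 y1.
have [|c] := @MVT_segment R sin cos 0 y y0 (fun t _ => is_derive_sin t).
  by apply: continuous_subspaceT; exact: continuous_sin.
rewrite in_itv /= => /andP[c0 cy]; rewrite sin0 !subr0 => ->.
have := cos_lip c 0; rewrite cos0 subr0 (ger0_norm c0) ler_norml => /andP[h _].
rewrite normrM (ger0_norm y0) ger0_norm; last by lra.
by nra.
Qed.

(** Exactly what makes a continuous logarithm vanishing at both ends regular. The class is closed
    under products and integer powers, so the Cayley factor may carry any exponent. *)
Definition near1 f := [/\ bholder f, exists2 c : R, 0 < c & forall x, c <= normc (f x) &
  decays (fun x => f x - 1)].

Lemma decay_pos x : 0 < 1 + `|x|. Proof. by rewrite ltr_pwDl. Qed.

Lemma decays_mull f g (M : R) : (forall x, normc (f x) <= M) -> decays g ->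
  decays (fun x => f x * g x).
Proof.
move=> fM [C gC]; exists (M * C) => x; rewrite normcM -mulrA.
by apply: ler_pM => //; exact: normc_ge0.
Qed.

Lemma decaysD f g : decays f -> decays g -> decays (fun x => f x + g x).
Proof.
move=> [C fC] [D gD]; exists (C + D) => x; rewrite mulrDl.
by apply: (le_trans (normcD_le _ _)); exact: lerD.
Qed.

Lemma decays_ext f g : f =1 g -> decays f -> decays g.
Proof. by move/funext ->. Qed.

Lemma near1_1 : near1 (fun=> 1).
Proof.
split; first exact: bholder_cst.
  by exists 1 => // x; rewrite normc1.
by exists 0 => x; rewrite subrr normc0 mul0r.
Qed.

Lemma near1M f g : near1 f -> near1 g -> near1 (fun x => f x * g x).
Proof.
move=> [bf [c c0 fc] df] [bg [d d0 gd] dg]; split; first exact: bholderM.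
  exists (c * d); first exact: mulr_gt0.
  by move=> x; rewrite normcM ler_pM // ltW.
have [M _ fM] := bholder_bounded bf.
apply: decays_ext (decaysD (decays_mull fM dg) df) => x /=; ring.
Qed.

Lemma near1V f : near1 f -> near1 (fun x => (f x)^-1).
Proof.
move=> [bf [c c0 fc] df].
have [M M0 fM] := bholder_bounded bf.
have bv := bholderV c0 fc bf; have [N _ vN] := bholder_bounded bv.
split => //.
  exists M^-1; first by rewrite invr_gt0.
  by move=> x; rewrite normcV lef_pV2 ?posrE // (lt_le_trans c0).
have vN' x : normc (- (f x)^-1) <= N by rewrite normc_opp.
apply: decays_ext (decays_mull vN' df) => x /=.
have fx : f x != 0.
  by apply/eqP => h; have := fc x; rewrite h normc0 leNgt c0.
by field.
Qed.

Lemma near1X f n : near1 f -> near1 (fun x => f x ^+ n).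
Proof.
move=> hf; elim: n => [|n IH].
  by under eq_fun do rewrite expr0; exact: near1_1.
by under eq_fun do rewrite exprS; exact: near1M.
Qed.

Lemma near1Xz f (n : int) : near1 f -> near1 (fun x => f x ^ n).
Proof.
move=> hf; case: n => n; first exact: near1X.
exact/near1V/near1X.
Qed.

(** The quotient is 1 - 2 i / (v + i), which gives the Hölder bound and the decay; numerator and
    denominator have equal modulus, which gives the lower bound. *)
Lemma near1_cayley : near1 (fun v => (v%:C - 'i) / (v%:C + 'i)).
Proof.
have sq v (s : R) : s ^+ 2 = 1 -> normc (v%:C + s%:C * 'i) = Num.sqrt (v ^+ 2 + 1).
  by move=> s2 /=; rewrite !mul0r !mulr0 !mulr1 subr0 addr0 add0r addr0 s2.
have n1 v : normc (v%:C + 'i) = Num.sqrt (v ^+ 2 + 1).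
  by rewrite -(sq v 1) ?expr1n // mul1r.
have n2 v : normc (v%:C - 'i) = Num.sqrt (v ^+ 2 + 1).
  by rewrite -(sq v (-1)) ?sqrrN ?expr1n // rmorphN1 mulN1r.
have ge1 v : 1 <= normc (v%:C + 'i).
  by rewrite n1 -[leLHS]sqrtr1 ler_wsqrtr // lerDr sqr_ge0.
have gev v : (1 + `|v|) / 2 <= normc (v%:C + 'i).
  have := ge1 v; have := normRe_le (v%:C + 'i); rewrite /= addr0; lra.
have nz v : v%:C + 'i != 0 :> R[i].
  by apply/eqP => h; have := ge1 v; rewrite h normc0 ler10.
have bV : bholder (fun v => (v%:C + 'i)^-1).
  exists 1, 1; split => // v.
    by rewrite normcV invf_le1 // (lt_le_trans ltr01).
  move=> w; rewrite powRr1 // mul1r.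
  have -> : (v%:C + 'i)^-1 - (w%:C + 'i)^-1 =
      (w - v)%:C * ((v%:C + 'i)^-1 * (w%:C + 'i)^-1).
    by rewrite rmorphB; field; rewrite !nz.
  rewrite !normcM !normcV normcR distrC ler_piMr //.
  by rewrite -invfM invf_le1 ?mulr_ege1 // mulr_gt0 // (lt_le_trans ltr01).
have dV : decays (fun v => (v%:C + 'i)^-1).
  exists 2 => v; rewrite normcV -[2]invrK -invfM lef_pV2 ?posrE; first by rewrite mulrC.
    by rewrite (lt_le_trans ltr01).
  by rewrite mulr_gt0 ?invr_gt0 // decay_pos.
have e v : (v%:C - 'i) / (v%:C + 'i) = 1 + (- 2 * 'i) * (v%:C + 'i)^-1. by field; exact: nz.
split.
- apply: bholder_ext (bholderD (bholder_cst 1) (bholderZ (-2 * 'i) bV)) => v.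
  by rewrite e.
- exists 1 => // v; rewrite normcM normcV n1 n2 mulfV // gt_eqF // sqrtr_gt0.
  by rewrite ltr_wpDl // sqr_ge0.
- apply: decays_ext (@decays_mull (fun=> -2 * 'i) _ _ (fun=> lexx _) dV) => v.
  by rewrite e addrAC subrr add0r.
Qed.

(** The ratio minus 1 is - 2 B / (A + B): the numerator is Gaussian and the denominator is bounded
    away from 0. *)
Lemma near1_symbol_ratio (xi : R) : xi != 0 -> `|xi| < Num.sqrt pi ->
  near1 (symbol_ratio xi).
Proof.
move=> xi0 xipi; have [c c0 hc] := symbol_lower_bound xi0 xipi.
have p1 v : c <= normc (A_ xi v + B_ v).
  by have := hc 1 v (or_introl erefl); rewrite mul1r.
have m1 v : c <= normc (A_ xi v - B_ v).
  by have := hc (-1) v (or_intror erefl); rewrite rmorphN1 mulN1r.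
have bA := bholder_A xi; have bB := @bholder_B R.
have bP := bholderD bA bB; have bM := bholderB bA bB.
have bV := bholderV c0 p1 bP.
have [M M0 PM] := bholder_bounded bP.
have [N N0 VN] := bholder_bounded bV.
split; first exact: bholderM.
  exists (c / M); first exact: divr_gt0.
  move=> v; rewrite /symbol_ratio normcM normcV ler_pM ?invr_ge0 ?(ltW c0) ?(ltW M0) //.
  by rewrite lef_pV2 ?posrE // (lt_le_trans c0).
have dB : decays (fun v => -2 * B_ v).
  exists (2 * (2 * Num.sqrt pi)) => v.
  have s0 : 0 <= Num.sqrt pi :> R := sqrtr_ge0 _.
  have -> : -2 * B_ v = (2 * (Num.sqrt pi * gauss v))%:C :> R[i].
    by rewrite /B_ pi_phi rmorphN mulrNN [RHS]rmorphM rmorph_nat.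
  rewrite normcR ger0_norm; last by rewrite !mulr_ge0 // ltW ?gauss_gt0.
  have := ler_wpM2l s0 (gauss_decay v); lra.
apply: decays_ext (decays_mull VN dB) => v.
have nz : A_ xi v + B_ v != 0.
  by apply/eqP => h; have := p1 v; rewrite h normc0 leNgt c0.
rewrite /symbol_ratio; move: (A_ xi v) (B_ v) nz => a b nz.
by field.
Qed.

End LogBranch.

(** * Regularity of a continuous logarithm *)

Section LogRegular.
Variable R : realType.
Implicit Types (f g : R -> R[i]) (v x y : R).

Lemma normcB_dist (z w : R[i]) : `|normc z - normc w| <= normc (z - w).
Proof.
rewrite ler_norml; apply/andP; split.
  have := normcD_le (w - z) z; rewrite subrK normcBC; lra.
have := normcD_le (z - w) w; rewrite subrK; lra.
Qed.

Lemma local_to_global_holder (th : R -> R) (a K T d : R) : 0 < a -> 0 < d ->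
  (forall x, `|th x| <= T) ->
  (forall x y, `|x - y| <= d -> `|th x - th y| <= K * `|x - y| `^ a) ->
  forall x y, `|th x - th y| <= (`|K| + 2 * T / d `^ a) * `|x - y| `^ a.
Proof.
move=> a0 d0 thT loc x y.
have T0 : 0 <= T := le_trans (normr_ge0 _) (thT 0).
have da : 0 < d `^ a by rewrite powR_gt0.
have [h|/ltW h] := leP `|x - y| d.
  apply: (le_trans (loc x y h)); rewrite ler_wpM2r ?powR_ge0 //.
  apply: (le_trans (ler_norm K)); rewrite lerDl divr_ge0 ?mulr_ge0 //; exact: ltW.
apply: (@le_trans _ _ (2 * T)).
  by apply: (le_trans (ler_normB _ _)); have := thT x; have := thT y; lra.
apply: (@le_trans _ _ (2 * T / d `^ a * d `^ a)); first by rewrite divfK // gt_eqF.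
apply: ler_pM; rewrite ?divr_ge0 ?mulr_ge0 ?powR_ge0 // ?lerDr //.
by apply: (ge0_ler_powR (ltW a0)); rewrite ?nnegrE // (le_trans (ltW d0)).
Qed.

Section Branch.
Variables (g L : R -> R[i]).
Hypotheses (ng : near1 g) (Lc : ccontinuous L) (Lg : forall v, cexp (L v) = g v).
Hypotheses (Lm : ccvg -oo L 0) (Lp : ccvg +oo L 0).

Let rho v := complex.Re (L v).
Let th v := complex.Im (L v).

Lemma log_re v : rho v = ln (normc (g v)).
Proof. by rewrite -Lg normc_cexp expRK. Qed.

Lemma log_norm_sin v : normc (g v) * sin (th v) = complex.Im (g v).
Proof. by rewrite -Lg normc_cexp. Qed.

Lemma log_norm_cos v : normc (g v) * cos (th v) = complex.Re (g v).
Proof. by rewrite -Lg normc_cexp. Qed.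

Lemma log_re_holder : exists2 C : R, 0 < C & forall x y,
  `|rho x - rho y| <= C * normc (g x - g y).
Proof.
have [_ [c c0 gc] _] := ng; exists c^-1; first by rewrite invr_gt0.
move=> x y; rewrite !log_re; apply: (le_trans (ln_lip c0 (gc x) (gc y))).
by rewrite mulrC ler_wpM2l ?invr_ge0 ?(ltW c0) // normcB_dist.
Qed.

Lemma log_re_decay : exists C : R, forall x, `|rho x| <= C / (1 + `|x|).
Proof.
have [_ [c c0 gc] [D gD]] := ng.
pose m := Num.min c 1.
have m0 : 0 < m by rewrite lt_min c0 ltr01.
have mg x : m <= normc (g x) by rewrite (le_trans _ (gc x)) // ge_min lexx.
have m1 : m <= 1 by rewrite ge_min lexx orbT.
exists (m^-1 * D) => x; have := ln_lip m0 (mg x) m1.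
rewrite ln1 subr0 -log_re => h; apply: (le_trans h).
rewrite mulrC -mulrA ler_wpM2l ?invr_ge0 ?(ltW m0) //.
by apply: le_trans (gD x); rewrite -{1}(@normc1 R) normcB_dist.
Qed.

(** |g x| |g y| sin (th x - th y) is the imaginary part of g x times the conjugate of g y. Replacing
    g x by g x - g y does not change it, since g y times its conjugate is real. For small angles the
    sine controls the angle. *)
Lemma log_im_diff x y : `|th x - th y| <= 2^-1 -> forall c, 0 < c ->
  (forall x, c <= normc (g x)) -> `|th x - th y| <= 4 / c * normc (g x - g y).
Proof.
move=> hd c c0 gc; apply: (le_trans (sin_lower hd)).
have nx : 0 < normc (g x) := lt_le_trans c0 (gc x).
have ny : 0 < normc (g y) := lt_le_trans c0 (gc y).
have e : normc (g y) * (normc (g x) * sin (th x - th y)) =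
    complex.Im (g x - g y) * complex.Re (g y) - complex.Re (g x - g y) * complex.Im (g y).
  rewrite sinB complex_ImB complex_ReB -!log_norm_sin -!log_norm_cos; ring.
have h : normc (g y) * (normc (g x) * `|sin (th x - th y)|) <= normc (g y) * (2 * normc (g x - g y)).
  have -> : normc (g y) * (normc (g x) * `|sin (th x - th y)|) =
      `|normc (g y) * (normc (g x) * sin (th x - th y))|.
    by rewrite !normrM (gtr0_norm nx) (gtr0_norm ny).
  rewrite e; apply: (le_trans (ler_normB _ _)); rewrite !normrM.
  have := normRe_le (g x - g y); have := normIm_le (g x - g y).
  have := normRe_le (g y); have := normIm_le (g y).
  move: (normr_ge0 (complex.Re (g y))) (normr_ge0 (complex.Im (g y)))
   (normr_ge0 (complex.Re (g x - g y))) (normr_ge0 (complex.Im (g x - g y))).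
  move=> p1 p2 p3 p4 q1 q2 q3 q4.
  have -> : normc (g y) * (2 * normc (g x - g y)) =
    normc (g x - g y) * normc (g y) + normc (g x - g y) * normc (g y) by ring.
  by apply: lerD; apply: ler_pM.
rewrite ler_pM2l // in h.
have -> : 4 / c * normc (g x - g y) = 2 * (2 * normc (g x - g y) / c) by field; rewrite gt_eqF.
rewrite ler_pM2l // ler_pdivlMr // mulrC; apply: le_trans h.
by rewrite ler_wpM2r.
Qed.

Lemma continuous_log_im : continuous th.
Proof. by move=> x; have [_] := Lc x. Qed.

(* If the argument moved by more than 1/2, it would move by exactly 1/2 at some
   intermediate point, where the difference of the values of g is too small. *)
Lemma log_im_small (c x y : R) : 0 < c -> (forall z, c <= normc (g z)) ->
  (forall z, `|x - z| <= `|x - y| -> normc (g x - g z) < c / 8) ->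
  `|th x - th y| <= 2^-1.
Proof.
move=> c0 gc hz; rewrite leNgt; apply/negP => hlt.
pose h z := `|th x - th z|.
have ch : continuous h.
  move=> z; apply: cvg_norm; apply: cvgB; first exact: cvg_cst.
  exact: continuous_log_im.
have hx : h x = 0 by rewrite /h subrr normr0.
have [z hz1 hz2] : exists2 z, `|x - z| <= `|x - y| & h z = 2^-1.
  have [xy|/ltW yx] := leP x y.
    have [||z] := @IVT _ h x y 2^-1 xy; first exact: continuous_subspaceT.
      by rewrite hx ge_min invr_ge0 ler0n /= le_max (ltW hlt) orbT.
    rewrite in_itv /= => /andP[xz zy] e; exists z => //.
    by rewrite !ler0_norm; lra.
  have [||z] := @IVT _ h y x 2^-1 yx; first exact: continuous_subspaceT.
    by rewrite hx ge_min invr_ge0 ler0n orbT /= le_max (ltW hlt).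
  rewrite in_itv /= => /andP[xz zy] e; exists z => //.
  by rewrite !ger0_norm; lra.
have := hz z hz1; have : `|th x - th z| <= 2^-1 by rewrite -/(h z) hz2.
move/log_im_diff => /(_ c c0 gc); rewrite -/(h z) hz2 => k1 k2.
have : 2^-1 < 4 / c * (c / 8) by apply: (le_lt_trans k1); rewrite ltr_pM2l // divr_gt0.
have -> : 4 / c * (c / 8) = 2^-1 by field; rewrite gt_eqF.
by rewrite ltxx.
Qed.

(** The limits 0 at both ends exclude other multiples of 2 pi: far out |th| <= 1/2, so the angle is
    controlled by its sine, that is by the imaginary part of g - 1, which decays. On the remaining
    compact interval the maximum of |th| serves. *)
Lemma log_im_decay : exists C : R, forall x, `|th x| <= C / (1 + `|x|).
Proof.
have [_ [c c0 gc] [D gD]] := ng.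
have far : exists2 V, 0 < V & forall x, V < `|x| -> `|th x| <= 2^-1.
  have [_ /cvgrPdist_le /(_ 2^-1)] := Lp; rewrite invr_gt0 ltr0n => /(_ isT) [V1 [_ hV1]].
  have [_ /cvgrPdist_le /(_ 2^-1)] := Lm; rewrite invr_gt0 ltr0n => /(_ isT) [V2 [_ hV2]].
  exists (`|V1| + `|V2| + 1) => [|x hx].
    by rewrite ltr_wpDl // addr_ge0.
  have n1 := ler_norm V1; have n2 := ler_norm (- V2); rewrite normrN in n2.
  have p1 := normr_ge0 V1; have p2 := normr_ge0 V2.
  have [x0|x0] := leP 0 x.
    have := hV1 x; rewrite sub0r normrN; apply.
    by rewrite (ger0_norm x0) in hx; lra.
  have := hV2 x; rewrite sub0r normrN; apply.
  by rewrite (ltr0_norm x0) in hx; lra.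
have [V V0 hV] := far.
have ch : {within `[- V, V], continuous (fun x => `|th x|)}.
  apply: continuous_subspaceT => z; apply: cvg_norm; exact: continuous_log_im.
have [|z _ hz] := @EVT_max R (fun x => `|th x|) (- V) V _ ch; first by lra.
have D0 : 0 <= D.
  have := le_trans (normc_ge0 _) (gD 0); rewrite normr0 addr0 divr1 //.
(* The first summand covers |x| <= V, where [z] is the maximum point, and the second covers |x| >
   V. *)
exists (`|th z| * (1 + V) + 2 * (D / c)) => x.
have Dc : 0 <= D / c by rewrite divr_ge0 // ltW.
have px := decay_pos x.
rewrite ler_pdivlMr //.
have [xV|xV] := leP `|x| V.
  have : `|th x| <= `|th z|.
    by apply: hz; rewrite in_itv /=; rewrite ler_norml in xV.
  have := normr_ge0 (th x); have := normr_ge0 (th z) => h1 h2 h3.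
  have : `|th x| * (1 + `|x|) <= `|th z| * (1 + V) by apply: ler_pM => //; lra.
  lra.
have hs := sin_lower (hV x xV).
have hi : `|complex.Im (g x)| <= D / (1 + `|x|).
  apply: le_trans (gD x); apply: le_trans (normIm_le _).
  by rewrite complex_ImB /= subr0.
have nx : 0 < normc (g x) := lt_le_trans c0 (gc x).
rewrite -log_norm_sin normrM (gtr0_norm nx) ler_pdivlMr // in hi.
have h1 : c * (`|sin (th x)| * (1 + `|x|)) <= D.
  apply: le_trans hi; rewrite mulrA ler_wpM2r ?(ltW px) // ler_wpM2r //.
have h2 : `|sin (th x)| * (1 + `|x|) <= D / c by rewrite ler_pdivlMr // mulrC.
have h3 : `|th x| * (1 + `|x|) <= 2 * `|sin (th x)| * (1 + `|x|).
  by rewrite ler_wpM2r // ltW.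
have : 0 <= `|th z| * (1 + V) by rewrite mulr_ge0 //; lra.
lra.
Qed.

(** The real part is a Lipschitz function of g. The imaginary part is first estimated at distances
    up to [d], where the argument cannot move by more than 1/2; beyond that its boundedness takes
    over. *)
Lemma log_regular : bholder L /\ decays L.
Proof.
have [rC hr] := log_re_decay; have [tC ht] := log_im_decay.
have [[a [M Hg]] [c c0 gc] _] := ng; have [a0 a1 M1 _ gH] := Hg.
have bdd (C : R) (f : R -> R) : (forall x, `|f x| <= C / (1 + `|x|)) -> forall x, `|f x| <= C.
  move=> h x; apply: (le_trans (h x)).
  have C0 : 0 <= C by have := le_trans (normr_ge0 _) (h 0); rewrite normr0 addr0 divr1.
  by rewrite ler_pdivrMr ?decay_pos // ler_peMr // lerDl.
split; last first.
  exists (rC + tC) => x; apply: (le_trans (normc_le_ReIm _)).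
  by rewrite mulrDl; apply: lerD; [exact: hr|exact: ht].
(* With this radius M d^a = c / 9, strictly below the c / 8 required by [log_im_small]. *)
pose d := (c / (9 * M)) `^ a^-1.
have M0 : 0 < M by lra.
have q0 : 0 < c / (9 * M) by rewrite divr_gt0 // mulr_gt0.
have d0 : 0 < d by rewrite powR_gt0.
have dE : d `^ a = c / (9 * M) by rewrite /d -powRrM mulVf ?gt_eqF // powRr1 // ltW.
have loc x y : `|x - y| <= d -> `|th x - th y| <= (4 / c * M) * `|x - y| `^ a.
  move=> xy; rewrite -mulrA.
  have sm : `|th x - th y| <= 2^-1.
    apply: (log_im_small c0 gc) => z xz; apply: (le_lt_trans (gH x z)).
    apply: (@le_lt_trans _ _ (M * d `^ a)).
      rewrite ler_wpM2l ?(ltW M0) //; apply: (ge0_ler_powR (ltW a0)); rewrite ?nnegrE ?(ltW d0) //.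
      exact: le_trans xz xy.
    rewrite dE; have -> : M * (c / (9 * M)) = c / 9 by field; rewrite gt_eqF.
    by rewrite ltr_pM2l // ltf_pV2 ?posrE // ltr_nat.
  apply: (le_trans (log_im_diff sm c0 gc)).
  by rewrite ler_wpM2l // divr_ge0 // ltW.
have bL : bholder (fun v => rho v +i* th v).
  apply: bholder_ReIm.
    have [C C0 hC] := log_re_holder.
    apply: (@bholder_real R rho a rC (C * M)) => //; first exact: bdd.
    move=> x y; apply: (le_trans (hC x y)); rewrite -mulrA ler_wpM2l //.
    exact: ltW.
  apply: (@bholder_real R th a tC) => //; first exact: bdd.
  by apply: local_to_global_holder a0 d0 (bdd _ _ ht) loc.
by apply: bholder_ext bL => v; rewrite /rho /th; case: (L v).
Qed.

End Branch.

Lemma log_branch_regular g : near1 g ->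
  bholder (log_branch g) /\ decays (log_branch g).
Proof.
move=> ng; rewrite /log_branch; case: xgetP => [L _ [Lc Lg Lm Lp]|_].
  exact: (log_regular ng Lc Lg Lm Lp).
split; first exact: bholder_cst.
by exists 0 => x; rewrite normc0 mul0r.
Qed.

Lemma log_symbol_regular (xi : R) : xi != 0 -> `|xi| < Num.sqrt pi ->
  bholder (log_symbol xi) /\ decays (log_symbol xi).
Proof.
move=> xi0 xipi; apply: log_branch_regular; apply: near1M.
  exact: (near1Xz _ (near1_cayley R)).
exact: near1_symbol_ratio.
Qed.

Lemma bholder_Gamma_plus (xi : R) : xi != 0 -> `|xi| < Num.sqrt pi ->
  bholder (Gamma_plus xi).
Proof.
move=> xi0 xipi; have [bL dL] := log_symbol_regular xi0 xipi.
have sL := decays_csquare bL dL.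
rewrite /Gamma_plus; under eq_fun do rewrite (pv_integral_chilb _ bL sL).
by apply: bholderD; apply: bholderZ => //; exact: bholder_chilb.
Qed.

End LogRegular.

(** * The dispersion relation *)

Section Dispersion.
Variable R : realType.
Notation mu := (@lebesgue_measure R).
Implicit Types (e v : R).

Definition Xi_kernel e v := e * phi v / (e ^+ 2 + v ^+ 2).

Lemma measurable_phi : measurable_fun setT (@phi R).
Proof. by apply/measurable_EFinP; exact: measurable_int (@integrable_phi R). Qed.

Lemma measurable_Xi_kernel e : measurable_fun setT (Xi_kernel e).
Proof.
apply: measurable_funM; first by apply: measurable_funM => //; exact: measurable_phi.
apply: (measurableT_comp (@measurable_invr R)).
by apply: measurable_funD => //; exact: measurable_funX.
Qed.

Lemma Xi_kernel_ge0 e v : 0 < e -> 0 <= Xi_kernel e v.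
Proof.
move=> e0; rewrite /Xi_kernel divr_ge0 //.
  by rewrite mulr_ge0 ?ltW // phi_gt0.
by rewrite addr_ge0 ?sqr_ge0.
Qed.

Lemma Xi_kernel_le e v : 0 < e -> Xi_kernel e v <= e^-1 * phi v.
Proof.
move=> e0; have p0 := phi_gt0 v.
rewrite /Xi_kernel ler_pdivrMr; last by rewrite ltr_wpDr ?sqr_ge0 // exprn_gt0.
rewrite -subr_ge0; have -> : e^-1 * phi v * (e ^+ 2 + v ^+ 2) - e * phi v = e^-1 * phi v * v ^+ 2.
  by field; rewrite gt_eqF.
by rewrite mulr_ge0 ?sqr_ge0 // mulr_ge0 ?invr_ge0 ?ltW.
Qed.

Lemma integrable_Xi_kernel e : 0 < e -> mu.-integrable setT (EFin \o Xi_kernel e).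
Proof.
move=> e0; apply: (integrable_domin (measurable_Xi_kernel e)
  (integrable_mull e^-1 (@integrable_phi R))) => v.
by rewrite ger0_norm ?Xi_kernel_ge0 // Xi_kernel_le.
Qed.

Lemma Xi_ge0 e : 0 < e -> 0 <= Xi e.
Proof. by move=> e0; apply: Rintegral_ge0 => v _; exact: Xi_kernel_ge0. Qed.

Lemma Xi_le e : 0 < e -> Xi e <= e^-1.
Proof.
move=> e0.
have -> : e^-1 = \int[mu]_v (e^-1 * phi v).
  by rewrite RintegralZl ?integral_phi ?mulr1 //; exact: integrable_phi.
apply: le_Rintegral => //; first exact: integrable_Xi_kernel.
  exact: (integrable_mull _ (@integrable_phi R)).
by move=> v _; exact: Xi_kernel_le.
Qed.

Lemma XiN e : 0 < e -> Xi (- e) = - Xi e.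
Proof.
move=> e0; have := RintegralZl (-1) measurableT (integrable_Xi_kernel e0).
rewrite mulN1r => <-.
by apply: eq_Rintegral => v _; rewrite /Xi_kernel sqrrN mulNr mulNr mulN1r.
Qed.

(** The kernels differ by phi v times (a - b) (v^2 - a b) over the product of the denominators; m^2
    v^2 and m^2 a b are each at most that product. The estimate stays away from 0, where [Xi] jumps,
    and provides continuity for the intermediate value theorem. *)
Lemma Xi_lip (m a b : R) : 0 < m -> m <= a -> m <= b ->
  `|Xi a - Xi b| <= 2 / m ^+ 2 * `|a - b|.
Proof.
move=> m0 ma mb; have a0 := lt_le_trans m0 ma; have b0 := lt_le_trans m0 mb.
have ia := integrable_Xi_kernel a0; have ib := integrable_Xi_kernel b0.
rewrite /Xi -[X in `|X|]RintegralB //.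
have i2 := integrable_mull (2 / m ^+ 2 * `|a - b|) (@integrable_phi R).
have md : measurable_fun setT (fun v => Xi_kernel a v - Xi_kernel b v).
  by apply: measurable_funB; exact: measurable_Xi_kernel.
apply: (le_trans (normr_Rintegral_le md i2 _)); last first.
  by rewrite RintegralZl ?integral_phi ?mulr1 //; exact: integrable_phi.
move=> v; rewrite /Xi_kernel.
move: (phi v) (phi_gt0 v) => p p0.
have v2 := sqr_ge0 v.
have a2 : 0 < a ^+ 2 by rewrite exprn_gt0.
have b2 : 0 < b ^+ 2 by rewrite exprn_gt0.
have m2 : 0 < m ^+ 2 by rewrite exprn_gt0.
have ma2 : m ^+ 2 <= a ^+ 2 by rewrite lerXn2r ?nnegrE // ltW.
have mb2 : m ^+ 2 <= b ^+ 2 by rewrite lerXn2r ?nnegrE // ltW.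
have mab : m ^+ 2 <= a * b by rewrite expr2 ler_pM // ltW.
have pa : 0 < a ^+ 2 + v ^+ 2 by lra.
have pb : 0 < b ^+ 2 + v ^+ 2 by lra.
have -> : a * p / (a ^+ 2 + v ^+ 2) - b * p / (b ^+ 2 + v ^+ 2) =
  p * (a - b) * ((v ^+ 2 - a * b) / ((a ^+ 2 + v ^+ 2) * (b ^+ 2 + v ^+ 2))).
  by field; rewrite !gt_eqF.
rewrite !normrM (gtr0_norm p0) [leRHS]mulrC -mulrA ler_wpM2l ?(ltW p0) //.
rewrite mulrC ler_wpM2r // normfV (gtr0_norm (mulr_gt0 pa pb)).
rewrite ler_pdivrMr ?mulr_gt0 //.
have h1 : `|v ^+ 2 - a * b| <= v ^+ 2 + a * b.
  by rewrite ler_norml; apply/andP; split; lra.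
apply: (le_trans h1); rewrite mulrAC ler_pdivlMr //.
have hab : (a * b) ^+ 2 = a ^+ 2 * b ^+ 2 by rewrite exprMn.
have h2 : v ^+ 2 * m ^+ 2 <= (a ^+ 2 + v ^+ 2) * (b ^+ 2 + v ^+ 2).
  have -> : (a ^+ 2 + v ^+ 2) * (b ^+ 2 + v ^+ 2) =
    v ^+ 2 * a ^+ 2 + (a ^+ 2 * b ^+ 2 + v ^+ 2 * b ^+ 2 + v ^+ 2 * v ^+ 2) by ring.
  apply: (@le_trans _ _ (v ^+ 2 * a ^+ 2)); first by rewrite ler_wpM2l.
  by rewrite lerDl !addr_ge0 // mulr_ge0 // ltW.
have h3 : a * b * m ^+ 2 <= (a ^+ 2 + v ^+ 2) * (b ^+ 2 + v ^+ 2).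
  have -> : (a ^+ 2 + v ^+ 2) * (b ^+ 2 + v ^+ 2) =
    a * b * (a * b) + (v ^+ 2 * a ^+ 2 + v ^+ 2 * b ^+ 2 + v ^+ 2 * v ^+ 2) by ring.
  apply: (@le_trans _ _ (a * b * (a * b))).
    by rewrite ler_wpM2l // mulr_ge0 // ltW.
  by rewrite lerDl !addr_ge0 // mulr_ge0 // ltW.
move: h2 h3; set X := (_ + _) * (_ + _) => h2 h3.
lra.
Qed.

(** On [-r, r] the density is at least phi r, and the Poisson kernel that remains has an arctangent
    as primitive. With r small and r / e large the bound comes close to pi phi 0 = sqrt pi. *)
Lemma Xi_lower (r e : R) : 0 < r -> 0 < e -> phi r * (2 * atan (r / e)) <= Xi e.
Proof.
move=> r0 e0.
have mA : measurable (`[- r, r]%classic : set R) by exact: measurable_itv.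
have iX := integrable_Xi_kernel e0.
pose k v := e / (e ^+ 2 + v ^+ 2).
have e2 v : 0 < e ^+ 2 + v ^+ 2 by rewrite ltr_wpDr ?sqr_ge0 // exprn_gt0.
have ck : continuous k.
  move=> v; apply: cvgM; first exact: cvg_cst.
  apply: cvgV; first by rewrite gt_eqF.
  by apply: cvgD; [exact: cvg_cst|exact: exprn_continuous].
have dF v : is_derive v 1 (fun v => atan (v / e)) (k v).
  have d1 : is_derive v 1 (fun v : R => v / e) (e^-1).
    by apply: is_derive_eq; rewrite /GRing.scale /= mulr1 mulr0 add0r.
  have d2 := @is_derive1_comp R (@atan R) (fun v : R => v / e) v _ _ (is_derive1_atan (v / e)) d1.
  apply: (@is_derive_eq _ _ _ _ _ _ _ _ d2).
  rewrite /k; field; rewrite !gt_eqF ?e2 //.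
have cF : continuous (fun v => atan (v / e)).
  by move=> v; have [/derivable1_diffP/differentiable_continuous] := dF v.
have ek : \int[mu]_(v in `[- r, r]) k v = 2 * atan (r / e).
  rewrite /Rintegral (@continuous_FTC2 R _ (fun v => atan (v / e))) //.
  - by rewrite -EFinB /= mulNr atanN; lra.
  - lra.
  - exact: continuous_subspaceT.
  - split; [by move=> v _; case: (dF v)| |].
    + exact/cvg_at_right_filter/cF.
    + exact/cvg_at_left_filter/cF.
  - by move=> v _; rewrite derive1E; have /= := @derive_val _ _ _ _ _ _ _ (dF v).
have ik : mu.-integrable (`[- r, r]%classic : set R) (EFin \o k) by exact: integrable_itv.
rewrite -ek -RintegralZl //.
apply: (@le_trans _ _ (\int[mu]_(v in `[- r, r]) Xi_kernel e v)).
  apply: le_Rintegral => //.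
  - by apply: integrable_itv => v; apply: cvgM; [exact: cvg_cst|exact: ck].
  - exact: integrableS iX.
  move=> v; rewrite /= in_itv /= -ler_norml => vr.
  rewrite /Xi_kernel /k -mulrA mulrA [phi r * e]mulrC -!mulrA ler_wpM2l ?(ltW e0) //.
  rewrite ler_wpM2r //.
    by rewrite mulr_ge0 ?invr_ge0 ?sqrtr_ge0 ?(ltW (e2 v)).
  rewrite ler_expR lerN2 -(@real_normK _ v) ?num_real //.
  by rewrite lerXn2r ?nnegrE // ltW.
rewrite Rintegral_mkcond; apply: le_Rintegral => //.
  have [+ _] := @integrable_mkcond _ _ R mu (`[- r, r]%classic : set R)
    (EFin \o Xi_kernel e) (measurable_itv _).
  by rewrite restrict_EFin; apply; exact: integrableS iX.
by move=> v _; rewrite patchE; case: ifP => // _; exact: Xi_kernel_ge0.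
Qed.

Lemma Xi_surj_pos (xi : R) : 0 < xi -> xi < Num.sqrt pi -> exists2 e, 0 < e & Xi e = xi.
Proof.
move=> x0 xpi; have s1 := @sqrt_pi_gt1 R; have sK := @sqrt_piK R.
set sp := Num.sqrt pi in s1 sK xpi *.
have sp0 : 0 < sp by exact: lt_trans s1.
(* 1 - r^2 becomes the midpoint of xi / sqrt pi and 1, so that pi phi r >= sqrt pi (1 - r^2) >
   xi. *)
pose r2 := (1 - xi / sp) / 2.
have q1 : xi / sp < 1 by rewrite ltr_pdivrMr // mul1r.
have r20 : 0 < r2 by rewrite divr_gt0 // subr_gt0.
pose r := Num.sqrt r2.
have r0 : 0 < r by rewrite sqrtr_gt0.
have rr : r ^+ 2 = r2 by rewrite sqr_sqrtr // ltW.
have pr0 := phi_gt0 r.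
have pr : xi < phi r * pi.
  rewrite mulrC pi_phi -/sp; apply: (@lt_le_trans _ _ (sp * (1 - r ^+ 2))).
    rewrite rr; have -> : sp * (1 - r2) = (sp + xi) / 2 by rewrite /r2; field; rewrite gt_eqF.
    lra.
  by rewrite ler_wpM2l ?gauss_ge // ltW.
pose q := xi / phi r.
have q0 : 0 < q by rewrite divr_gt0.
have qpi : q < pi by rewrite ltr_pdivrMr // mulrC.
(* The midpoint of q / 2 and pi / 2. Taking e1 = r / tan th makes the bound of [Xi_lower] equal to 2
   phi r th, which exceeds phi r q = xi. *)
pose th := (q / 2 + pi / 2) / 2.
have thB : th \in `](- (pi / 2)), (pi / 2)[ by rewrite in_itv /= /th; apply/andP; split; lra.
pose t := tan th.
have tE : atan t = th by rewrite tanK.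
have t0 : 0 < t.
  rewrite ltNge; apply/negP; rewrite le_eqVlt => /predU1P[h|h].
    by move: tE; rewrite h atan0 /th; lra.
  have : atan t < atan 0.
    by apply: lt_atan.
  by rewrite atan0 tE /th; lra.
pose e1 := r / t.
have e10 : 0 < e1 by rewrite divr_gt0.
have X1 : xi < Xi e1.
  apply: lt_le_trans (Xi_lower r0 e10).
  have -> : r / e1 = t by rewrite /e1; field; rewrite !gt_eqF.
  rewrite tE mulrC -ltr_pdivrMr // -/q /th; lra.
(* [Xi_le] then gives Xi e2 <= xi / 2. *)
pose e2 := 2 / xi.
have e20 : 0 < e2 by rewrite divr_gt0.
have X2 : Xi e2 < xi.
  apply: (le_lt_trans (Xi_le e20)); rewrite /e2 invf_div; lra.
have e12 : e1 <= e2.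
  have h := lt_le_trans X1 (Xi_le e10).
  have : e1 < xi^-1 by rewrite -[ltLHS]invrK ltf_pV2 ?posrE ?invr_gt0.
  have : xi^-1 <= e2 by rewrite /e2 ler_peMl ?invr_ge0 ?(ltW x0) // ler1n.
  lra.
have cX : {within `[e1, e2], continuous (@Xi R)}.
  apply: continuous_in_subspaceT => z; rewrite inE /= in_itv /= => /andP[z1 _].
  pose m := e1 / 2; have m0 : 0 < m by rewrite divr_gt0.
  apply/cvgrPdist_le => eps eps0; near=> y.
  have my : m <= y.
    have : `|z - y| <= m by near: y; apply: cvgr_dist_le => //; exact: cvg_id.
    by rewrite ler_norml => /andP[_]; rewrite /m; lra.
  have mz : m <= z by rewrite /m; lra.
  have dy : `|z - y| <= eps / (2 / m ^+ 2).
    near: y; apply: cvgr_dist_le; first exact: cvg_id.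
    by rewrite divr_gt0 // divr_gt0 // exprn_gt0.
  apply: (le_trans (Xi_lip m0 mz my)).
  by rewrite mulrC -ler_pdivlMr // divr_gt0 // exprn_gt0.
have [|e] := @IVT R (@Xi R) e1 e2 xi e12 cX.
  by rewrite ge_min (ltW X2) orbT le_max (ltW X1).
rewrite in_itv /= => /andP[h _] Xe; exists e => //.
exact: lt_le_trans h.
Unshelve. all: by end_near. Qed.

Lemma Xi_eta (xi : R) : xi != 0 -> `|xi| < Num.sqrt pi ->
  eta xi != 0 /\ Xi (eta xi) = xi.
Proof.
move=> xi0 xipi.
have h : xi \in (@Xi R) @` [set e : R | e != 0].
  rewrite inE /=; have [x0|x0] := leP 0 xi.
    have [||e e0 Xe] := @Xi_surj_pos xi; first by rewrite lt_neqAle eq_sym xi0.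
      by rewrite ger0_norm in xipi.
    by exists e => //=; rewrite gt_eqF.
  have [||e e0 Xe] := @Xi_surj_pos (- xi); first by rewrite oppr_gt0.
    by rewrite ltr0_norm in xipi.
  exists (- e); first by rewrite /= oppr_eq0 gt_eqF.
  by rewrite XiN // Xe opprK.
have e := pinvK (fun=> 0) h; split => //.
(* At 0 the integrand of [Xi] vanishes identically, so Xi (eta xi) = xi excludes the value 0. *)
apply/eqP => e0; move: e; rewrite -/(eta xi) e0 => e.
have X0 : Xi 0 = 0 :> R.
  rewrite /Xi; under eq_Rintegral do rewrite !mul0r.
  by rewrite Rintegral_cst // mul0r.
by rewrite -e X0 eqxx in xi0.
Qed.

(** [Xi] is odd and nonnegative on positive arguments, so eta xi and xi = Xi (eta xi) have the same
    sign; neither is 0. *)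
Lemma xi_eta_gt0 (xi : R) : xi != 0 -> `|xi| < Num.sqrt pi -> 0 < xi * eta xi.
Proof.
move=> xi0 xipi; have [e0 Xe] := Xi_eta xi0 xipi.
rewrite lt_neqAle eq_sym mulf_neq0 //=.
have [h|h] := ltP 0 (eta xi).
  by rewrite mulr_ge0 ?(ltW h) // -Xe Xi_ge0.
have h' : 0 < - eta xi by rewrite oppr_gt0 lt_neqAle e0.
have := XiN h'; rewrite opprK Xe => e.
have xi_le0 : 0 <= - xi by rewrite e opprK Xi_ge0.
by rewrite -mulrNN mulr_ge0 // ltW.
Qed.

End Dispersion.

(** * Asymptotics *)

Section Decomposition.
Variable R : realType.
Notation mu := (@lebesgue_measure R).
Implicit Types (f g : R -> R[i]) (xi v x y : R).

(** Made for [gd_den], which is unbounded in v and hence outside [bholder]: a Lipschitz bound and a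
    lower bound still put its inverse inside. *)
Lemma bholder_inv_lip f (c D : R) : 0 < c -> (forall x, c <= normc (f x)) ->
  (forall x y, normc (f x - f y) <= D * `|x - y|) -> bholder (fun x => (f x)^-1).
Proof.
move=> c0 fc fD.
have nz z : f z != 0.
  by apply/eqP => h; have := fc z; rewrite h normc0 leNgt c0.
have Vc x : normc (f x)^-1 <= c^-1.
  by rewrite normcV lef_pV2 ?posrE // (lt_le_trans c0).
have D0 : 0 <= D.
  by have := le_trans (normc_ge0 _) (fD 1 0); rewrite subr0 normr1 mulr1.
have c0' : 0 <= c^-1 by rewrite invr_ge0 ltW.
exists 1, (1 + c^-1 + c^-1 * c^-1 * D); split => //.
- by rewrite -addrA lerDl addr_ge0 // !mulr_ge0.
- move=> x; apply: (le_trans (Vc x)).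
  have : 0 <= c^-1 * c^-1 * D by rewrite !mulr_ge0.
  lra.
- move=> x y; rewrite powRr1 //.
  have -> : (f x)^-1 - (f y)^-1 = (f y - f x) * ((f x)^-1 * (f y)^-1).
    by field; rewrite !nz.
  rewrite !normcM normcBC mulrC.
  apply: (@le_trans _ _ (c^-1 * c^-1 * (D * `|x - y|))).
    by apply: ler_pM; rewrite ?mulr_ge0 ?normc_ge0 // ler_pM ?normc_ge0.
  by rewrite mulrA ler_wpM2r // lerDr addr_ge0.
Qed.

Lemma eq_oppr0 x : - x = x -> x = 0. Proof. lra. Qed.

Lemma gd_den0 v : gd_den 0 v = 1 :> R[i].
Proof. by rewrite /gd_den /Lambda eqxx mul0r rmorph0 mul0r !addr0. Qed.

Lemma gd_denE xi v : xi != 0 -> gd_den xi v = (xi * eta xi) +i* (xi * v).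
Proof.
move=> xi0; rewrite /gd_den /Lambda (negbTE xi0).
rewrite [RHS]complexE rmorphD rmorphN1 addrA subrr add0r.
congr (_ + _); exact: mulrC.
Qed.

Lemma gd_den_lower xi : xi != 0 -> `|xi| < Num.sqrt pi ->
  forall v, xi * eta xi <= normc (gd_den xi v).
Proof.
move=> xi0 xipi v; rewrite gd_denE //.
by apply: le_trans (normRe_le _); rewrite /= ler_norm.
Qed.

Lemma gd_den_neq0 xi v : `|xi| < Num.sqrt pi -> gd_den xi v != 0.
Proof.
move=> xipi; have [->|xi0] := eqVneq xi 0; first by rewrite gd_den0 oner_neq0.
have h := gd_den_lower xi0 xipi v; have h0 := xi_eta_gt0 xi0 xipi.
by apply/eqP => e; move: h; rewrite e normc0 leNgt h0.
Qed.

Lemma bholder_gd_denV xi : xi != 0 -> `|xi| < Num.sqrt pi ->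
  bholder (fun v => (gd_den xi v)^-1).
Proof.
move=> xi0 xipi.
apply: (@bholder_inv_lip _ _ `|xi| (xi_eta_gt0 xi0 xipi) (gd_den_lower xi0 xipi)).
move=> x y; have -> : gd_den xi x - gd_den xi y = (xi * (x - y))%:C * 'i.
  by rewrite /gd_den opprD addrACA subrr add0r -mulrBl -rmorphB -mulrBr.
by rewrite normcM normc_i mulr1 normcR normrM.
Qed.

Lemma cintegrable_phi : cintegrable setT (fun v => (phi v)%:C).
Proof.
split; first exact: integrable_phi.
exact: integrable0.
Qed.

(** By linearity it suffices to integrate phi / gd_den. For xi <> 0 its real part is the kernel of
    [Xi] at eta xi divided by xi, with integral 1, and its imaginary part is odd in v. For xi = 0
    only the total mass of phi remains. *)
Lemma gd_density (c : R[i]) xi : `|xi| < Num.sqrt pi ->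
  cintegral setT (fun v => (phi v)%:C * (c / gd_den xi v)) = c.
Proof.
move=> xipi; pose h v := (gd_den xi v)^-1 * (phi v)%:C.
have [[h1 h2] e1 e2] : [/\ cintegrable setT h,
    \int[mu]_v complex.Re (h v) = 1 & \int[mu]_v complex.Im (h v) = 0].
  have [xi0|xi0] := eqVneq xi 0.
    have -> : h = fun v => (phi v)%:C by apply/funext => v; rewrite /h xi0 gd_den0 invr1 mul1r.
    by split; [exact: cintegrable_phi|exact: integral_phi|rewrite Rintegral_cst // mul0r].
  have ih : cintegrable setT h.
    exact: cintegrableM (bholder_gd_denV xi0 xipi) cintegrable_phi.
  have [n0 Xe] := Xi_eta xi0 xipi; have [ih1 ih2] := ih.
  have den v : eta xi ^+ 2 + v ^+ 2 != 0.
    by rewrite gt_eqF // ltr_wpDr ?sqr_ge0 // exprn_even_gt0.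
  have hE v : h v = (xi^-1 * Xi_kernel (eta xi) v) +i* (xi^-1 * - (v * phi v / (eta xi ^+ 2 + v ^+ 2))).
    rewrite /h gd_denE // /Xi_kernel.
    move: (phi v) (eta xi) n0 (den v) => p e n0 den'.
    have d2 : (xi * e) ^+ 2 + (xi * v) ^+ 2 != 0.
      by rewrite !exprMn -mulrDr mulf_neq0 // expf_neq0.
    apply/eqP; rewrite eq_complex /=; apply/andP; split; apply/eqP.
      by field; rewrite den' d2 xi0.
    by field; rewrite den' d2 xi0.
  have ReE v : complex.Re (h v) = xi^-1 * Xi_kernel (eta xi) v by rewrite hE.
  split => //.
    have iX : mu.-integrable setT (EFin \o Xi_kernel (eta xi)).
      have := integrable_mull xi ih1; apply: eq_integrable => // v _.
      by rewrite -[LHS]/((xi * complex.Re (h v))%:E) ReE mulrA mulfV // mul1r.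
    under eq_Rintegral do rewrite ReE.
    by rewrite RintegralZl // -/(Xi (eta xi)) Xe mulVf.
  (* Reflection turns the integral of the odd imaginary part into its opposite. *)
  have [_ e] := integrable_preserves (preserves_subl 0) ih2.
  have e3 : \int[mu]_v (-1 * complex.Im (h v)) = \int[mu]_v complex.Im (h (0 - v)).
    apply: eq_Rintegral => v _; rewrite !hE sub0r sqrrN /phi sqrrN /=; ring.
  have e4 := RintegralZl (-1) measurableT ih2.
  apply: eq_oppr0; rewrite -mulN1r.
  exact: (etrans (esym e4) (etrans e3 e)).
rewrite (_ : (fun v => _) = fun v => c * h v); last first.
  by apply/funext => v; rewrite /h; ring.
rewrite /cintegral; case: c => a b.
have RL (k1 k2 : R) : \int[mu]_v (k1 * complex.Re (h v) + k2 * complex.Im (h v)) = k1.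
  rewrite RintegralD //; try exact: integrable_mull.
  by rewrite !RintegralZl // e1 e2 mulr1 mulr0 addr0.
congr (_ +i* _).
  rewrite -[RHS](RL a (- b)); apply: eq_Rintegral => v _.
  by rewrite complex_ReM /=; ring.
rewrite -[RHS](RL b a); apply: eq_Rintegral => v _.
by rewrite complex_ImM /=; ring.
Qed.

(** Average |u x| <= M + |u y| over y in [x, x + 1]. *)
Lemma holder_integrable_bounded (u : R -> R) (a M : R) : 0 < a -> 0 <= M ->
  holder_bound a M u -> mu.-integrable setT (EFin \o u) ->
  forall x, `|u x| <= M + \int[mu]_y `|u y|.
Proof.
move=> a0 M0 Hu iu x.
have cu := holder_bound_continuous a0 Hu.
have cn : continuous (fun y => `|u y|) by move=> y; apply: cvg_norm; exact: cu.
have iu' : mu.-integrable setT (EFin \o (fun y => `|u y|)) by exact: integrable_norm.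
have x1 : x <= x + 1 by rewrite lerDl.
have h : \int[mu]_(y in `[x, x + 1]) `|u x| <= \int[mu]_(y in `[x, x + 1]) (M + `|u y|).
  apply: le_Rintegral_itv.
  - by move=> y; exact: cvg_cst.
  - by move=> y; apply: cvgD; [exact: cvg_cst|exact: cn].
  move=> y xy yx; have d1 : `|x - y| <= 1 by rewrite ler0_norm; lra.
  have d2 : `|x - y| `^ a <= 1.
    have -> : 1 = 1 `^ a :> R by rewrite powR1.
    by apply: (ge0_ler_powR (ltW a0)); rewrite ?nnegrE.
  have := Hu x y; have := ler_normD (u x - u y) (u y); rewrite subrK.
  have : M * `|x - y| `^ a <= M by rewrite ler_piMr.
  lra.
have xx : x + 1 - x = 1 by ring.
rewrite Rintegral_itv_cst // xx mulr1 in h; apply: (le_trans h).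
rewrite RintegralD //; last first.
- exact: integrable_itv.
- by apply: integrable_itv => y; exact: cvg_cst.
rewrite Rintegral_itv_cst // xx mulr1 lerD2l.
rewrite Rintegral_mkcond; apply: le_Rintegral => //.
  have [+ _] := @integrable_mkcond _ _ R mu (`[x, (x + 1)]%classic : set R)
    (EFin \o (fun y => `|u y|)) (measurable_itv _).
  by rewrite restrict_EFin; apply; exact: integrable_itv.
move=> y _; rewrite patchE; case: ifP => _ //; exact: normr_ge0.
Qed.

Lemma bholder_of_integrable f : holder_continuous f -> cintegrable setT f -> bholder f.
Proof.
move=> [C [a [a0 a1 fH]]] [i1 i2].
have H1 : holder_bound a `|C| (fun x => complex.Re (f x)).
  move=> x y; rewrite -complex_ReB (le_trans (normRe_le _)) // (le_trans (fH x y)) //.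
  by rewrite ler_wpM2r ?powR_ge0 // ler_norm.
have H2 : holder_bound a `|C| (fun x => complex.Im (f x)).
  move=> x y; rewrite -complex_ImB (le_trans (normIm_le _)) // (le_trans (fH x y)) //.
  by rewrite ler_wpM2r ?powR_ge0 // ler_norm.
have b : bholder (fun x => complex.Re (f x) +i* complex.Im (f x)).
  apply: bholder_ReIm; apply: (@bholder_real _ _ a _ `|C|) => //.
    exact: holder_integrable_bounded a0 (normr_ge0 C) H1 i1.
  exact: holder_integrable_bounded a0 (normr_ge0 C) H2 i2.
by apply: bholder_ext b => x; case: (f x).
Qed.

(** Each summand of K0 is a bounded Hölder function times an integrable one. In the first that
    factor is F0; in the second it is B, as the Hilbert transform itself is only known to be bounded
    and Hölder. *)
Lemma K0_regular (g : R -> R -> R[i]) xi : xi != 0 -> `|xi| < Num.sqrt pi ->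
  cintegrable setT (fun v => (phi v)%:C * g xi v) ->
  holder_continuous (F0 g xi) ->
  bholder (K0 g xi) /\ cintegrable setT (K0 g xi).
Proof.
move=> xi0 xipi ig hF.
have [c c0 hc] := symbol_lower_bound xi0 xipi.
have p1 v : c <= normc (A_ xi v + B_ v).
  by have := hc 1 v (or_introl erefl); rewrite mul1r.
have m1 v : c <= normc (A_ xi v - B_ v).
  by have := hc (-1) v (or_intror erefl); rewrite rmorphN1 mulN1r.
have bA := bholder_A xi; have bB := @bholder_B R.
have bP := bholderV c0 p1 (bholderD bA bB).
have bM := bholderV c0 m1 (bholderB bA bB).
have bG := bholder_Gamma_plus xi0 xipi; have bE := bholder_cexp bG.
have [N N0 GN] := bholder_bounded bG.
have bEV : bholder (fun v => (cexp (Gamma_plus xi v))^-1).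
  apply: (bholderV (expR_gt0 (- N)) _ bE) => v.
  rewrite normc_cexp ler_expR lerNl (le_trans (ler_norm _)) // normrN.
  exact: le_trans (normRe_le _) (GN v).
have iF : cintegrable setT (F0 g xi).
  have i1 := cintegrableM (bholderZ (- C0 g xi) (bholder_gd_denV xi0 xipi)) cintegrable_phi.
  have := cintegrableD ig i1; congr cintegrable; apply/funext => v.
  by rewrite /F0; ring.
have bF := bholder_of_integrable hF iF.
pose G tau := F0 g xi tau / (cexp (Gamma_plus xi tau) * (A_ xi tau + B_ tau)).
have GE tau : (cexp (Gamma_plus xi tau))^-1 * (A_ xi tau + B_ tau)^-1 * F0 g xi tau = G tau.
  by rewrite /G invfM mulrC.
have bEP := bholderM bEV bP.
have bG' : bholder G by apply: bholder_ext (bholderM bEP bF) => v; exact: GE.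
have iG : cintegrable setT G.
  by have := cintegrableM bEP iF; congr cintegrable; apply/funext => v; exact: GE.
have sG := cintegrable_csquare bG' iG.
have iB : cintegrable setT (@B_ R).
  have := cintegrableM (bholder_cst (- pi)%:C) cintegrable_phi.
  by congr cintegrable; apply/funext => v; rewrite -rmorphM mulNr.
have e2 v : (A_ xi v ^+ 2 - B_ v ^+ 2)^-1 = (A_ xi v - B_ v)^-1 * (A_ xi v + B_ v)^-1.
  by rewrite subr_sqr invfM.
have iK : cintegrable setT (K0 g xi).
  have j1 := cintegrableM (bholderM bA (bholderM bM bP)) iF.
  have b2 := bholderM (bholderM bE bM) (bholderZ (- (pi%:C * 'i)^-1) (bholder_chilb bG' sG)).
  have j2 := cintegrableM b2 iB.
  have := cintegrableD j1 j2; congr cintegrable; apply/funext => v.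
  rewrite /K0 (pv_integral_chilb v bG' sG) e2.
  move: (chilb G v) (A_ xi v) (B_ v) (A_ xi v + B_ v)^-1 (A_ xi v - B_ v)^-1
    (F0 g xi v) (cexp (Gamma_plus xi v)) (pi%:C * 'i)^-1.
  by move=> *; ring.
split => //.
have b1 := bholderM (bholderM bA (bholderM bM bP)) bF.
have b2 := bholderM (bholderM (bholderM bE bB) bM) (bholderZ ((pi%:C * 'i)^-1) (bholder_chilb bG' sG)).
apply: bholder_ext (bholderB b1 b2) => v.
by rewrite /K0 (pv_integral_chilb v bG' sG) e2.
Qed.

Lemma invc_i : ('i : R[i])^-1 = - 'i.
Proof.
have i0 : 'i != 0 :> R[i] by rewrite eq_complex /= eqxx oner_eq0.
by apply: (mulfI i0); rewrite mulfV // mulrN -expr2 sqr_i opprK.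
Qed.

Definition wave xi (t : R) (w : R) : R[i] := cexp (- 'i * (xi * w * t)%:C).

Lemma waveE xi t w : wave xi t w = cos (xi * w * t) -i* sin (xi * w * t).
Proof.
rewrite /wave /cexp /=.
have -> : - 0 * (xi * w * t) - - 1 * 0 = 0 :> R by ring.
have -> : - 0 * 0 + - 1 * (xi * w * t) = - (xi * w * t) :> R by ring.
by rewrite expR0 !mul1r cosN sinN.
Qed.

Lemma normc_wave xi t w : normc (wave xi t w) = 1.
Proof. by rewrite waveE /= sqrrN cos2Dsin2 sqrtr1. Qed.

(** At distances up to 1 the Lipschitz constant is proportional to |xi| t; beyond 1 the modulus 1 of
    both waves suffices, as the power is at least 1. *)
Lemma wave_holder xi t (a x y : R) : 0 <= t -> 0 < a -> a <= 1 ->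
  normc (wave xi t x - wave xi t y) <= 2 * (1 + `|xi| * t) * `|x - y| `^ a.
Proof.
move=> t0 a0 a1; have k0 : 0 <= `|xi| * t by rewrite mulr_ge0.
have [d1|/ltW d1] := leP `|x - y| 1.
  apply: (@le_trans _ _ (2 * (`|xi| * t) * `|x - y|)).
    apply: (le_trans (normc_le_ReIm _)); rewrite complex_ReB complex_ImB !waveE /=.
    have -> : 2 * (`|xi| * t) * `|x - y| = `|xi * x * t - xi * y * t| + `|xi * x * t - xi * y * t|.
      have -> : xi * x * t - xi * y * t = xi * t * (x - y) by ring.
      by rewrite !normrM (ger0_norm t0); ring.
    apply: lerD; first exact: cos_lip.
    rewrite opprK addrC (distrC (xi * x * t)); exact: sin_lip.
  apply: ler_pM; rewrite ?mulr_ge0 //; first lra.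
  by rewrite -[leLHS]powRr1 //; exact: powR_dist_le.
apply: (le_trans (normcB_le _ _)); rewrite !normc_wave.
have : 1 <= `|x - y| `^ a by rewrite -[leLHS](powRr0 `|x - y|) ler_powR // ltW.
by nra.
Qed.

Lemma wave_growth_arith (x s : R) : 0 <= x -> 0 <= s ->
  3 + 2 * (x * s) <= (3 + 2 * x) * (1 + s).
Proof. by move=> x0 s0; nra. Qed.

Lemma pv_bound_arith (m n k I1 I2 S K t : R) : 0 <= t -> 0 <= S -> 0 <= K ->
  n * k <= m * (1 + t) * k -> I1 <= S -> I2 <= S ->
  (4 * n * k + 2 * I1 + 2 * K) + (4 * n * k + 2 * I2 + 2 * K) <=
  (8 * m * k + 4 * S + 4 * K) * (1 + t).
Proof.
move=> t0 S0 K0 h h1 h2; have : 0 <= S * t by rewrite mulr_ge0.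
have : 0 <= K * t by rewrite mulr_ge0.
lra.
Qed.

Lemma pv_wave_bound f xi v : bholder f -> cintegrable setT f ->
  exists K : R, forall t, 0 <= t ->
    normc (pv_integral v (fun w => wave xi t w * f w / ('i * (w - v)%:C))) <= K * (1 + t).
Proof.
move=> bf intf; have [a [M Hf]] := bf; have [a0 a1 M1 fM fH] := Hf.
have M0 : 0 < M by lra.
have [s1 s2] := cintegrable_csquare bf intf.
pose S : R := (\int[mu]_w (complex.Re (f w) ^+ 2)) + \int[mu]_w (complex.Im (f w) ^+ 2).
pose Ka : R := \int[mu]_s kap a s; pose K1 : R := \int[mu]_s kap 1 s.
have S0 : 0 <= S by rewrite addr_ge0 // Rintegral_ge0 // => w _; exact: sqr_ge0.
have Ka0 : 0 <= Ka by rewrite Rintegral_ge0 // => w _; exact: kap_ge0.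
have K10 : 0 <= K1 by rewrite Rintegral_ge0 // => w _; exact: kap_ge0.
(* M (3 + 2 |xi| t) = 2 (1 + |xi| t) M + M: the increment of the wave times [f], plus the wave times
   the increment of [f]. *)
pose Mt t := M * (3 + 2 * (`|xi| * t)).
exists (8 * (M * (3 + 2 * `|xi|)) * Ka + 4 * S + 4 * K1) => t t0.
have k0 : 0 <= `|xi| * t by rewrite mulr_ge0.
pose ft w := - 'i * (wave xi t w * f w).
have Mt1 : 1 <= Mt t by rewrite /Mt; nra.
have nft w : normc (ft w) = normc (f w).
  by rewrite /ft normcM normc_opp normc_i mul1r normcM normc_wave mul1r.
have Hft : bholder_with a (Mt t) ft.
  split => //.
    by move=> w; rewrite nft (le_trans (fM w)) // /Mt; nra.
  move=> x y; rewrite /ft -mulrBr normcM normc_opp normc_i mul1r.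
  have -> : wave xi t x * f x - wave xi t y * f y =
    (wave xi t x - wave xi t y) * f x + wave xi t y * (f x - f y) by ring.
  apply: (le_trans (normcD_le _ _)); rewrite !normcM normc_wave mul1r.
  have := wave_holder xi x y t0 a0 a1; have := fH x y; have := fM x.
  have := normc_ge0 (f x); have := powR_ge0 `|x - y| a.
  set d := _ `^ _; set p := normc (f x); set q := normc (wave xi t x - _) => d0 p0 pM h1 h2.
  have h3 : q * p <= 2 * (1 + `|xi| * t) * d * M.
    by apply: ler_pM => //; exact: normc_ge0.
  have -> : Mt t * d = 2 * (1 + `|xi| * t) * d * M + M * d by rewrite /Mt; ring.
  exact: lerD.
have bft : bholder ft by exists a, (Mt t).
have [m1 m2] := bholder_measurable bft.
(* The wave mixes the real and imaginary parts of [f], so each part of the product is compared with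
   the modulus of [f]. *)
have dom (u : R -> R) : measurable_fun setT u -> (forall w, `|u w| <= normc (f w)) ->
    square_integrable u /\ \int[mu]_w (u w ^+ 2) <= S.
  move=> mu' uf; have ile w : `|u w ^+ 2| <= complex.Re (f w) ^+ 2 + complex.Im (f w) ^+ 2.
    rewrite normrX -normc_sq lerXn2r ?nnegrE ?normc_ge0 //.
  have isq := integrable_addr s1 s2.
  have mu2 : measurable_fun setT (fun w => u w ^+ 2) by exact: measurable_funX.
  split; first exact: (integrable_domin mu2 isq ile).
  apply: (le_trans (ler_norm _)); apply: (le_trans (normr_Rintegral_le mu2 isq ile)).
  by rewrite RintegralD.
have [q1 le1] := dom _ m1 (fun w => le_trans (normRe_le _) (eq_ind _ (fun z => z <= _) (lexx _) _ (esym (nft w)))).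
have [q2 le2] := dom _ m2 (fun w => le_trans (normIm_le _) (eq_ind _ (fun z => z <= _) (lexx _) _ (esym (nft w)))).
have -> : (fun w => wave xi t w * f w / ('i * (w - v)%:C)) = (fun w => ft w / (w - v)%:C).
  apply/funext => w; rewrite /ft invfM invc_i.
  move: (wave xi t w) (f w) ((w - v)%:C)^-1 => p q r; ring.
rewrite pv_integral_chilb //.
apply: (le_trans (normc_le_ReIm _)); rewrite /chilb /=.
have b1 := hilb_le a0 a1 Mt1 (bholder_with_Re Hft) q1 v.
have b2 := hilb_le a0 a1 Mt1 (bholder_with_Im Hft) q2 v.
apply: (le_trans (lerD b1 b2)); rewrite -/Ka -/K1.
apply: pv_bound_arith => //.
apply: ler_wpM2r => //; rewrite /Mt -mulrA.
by apply: ler_wpM2l; [exact: ltW|exact: wave_growth_arith].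
Qed.

Lemma linear_exp_cvg0 (K c : R) (q : R -> R[i]) : 0 < c ->
  (forall t, 0 <= t -> normc (q t - 1) <= expR (- (c * t)) * (K * (1 + t))) ->
  ccvg +oo q 1.
Proof.
move=> c0 hq.
have main eps : 0 < eps -> \forall t \near +oo, normc (q t - 1) <= eps.
  move=> e0; near=> t.
  have t1 : 1 <= t by near: t; apply: nbhs_pinfty_ge; rewrite num_real.
  (* From here on the quadratic term in e^(c t) >= 1 + (c t)^2 / 2 outweighs K (1 + t) <= 2 |K| t by
     the factor 1 / eps. *)
  have tT : 4 * `|K| / (c ^+ 2 * eps) <= t by near: t; apply: nbhs_pinfty_ge; rewrite num_real.
  have t0 : 0 < t by lra.
  apply: (le_trans (hq t (ltW t0))).
  have ct : 0 <= c * t by rewrite mulr_ge0 // ltW.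
  have h := expR_ge1Dxn 1 ct; have E0 := expR_gt0 (c * t).
  rewrite expRN mulrC ler_pdivrMr //.
  have c2 : 0 < c ^+ 2 by rewrite exprn_gt0.
  rewrite ler_pdivrMr ?mulr_gt0 // in tT.
  have K1 : K * (1 + t) <= `|K| * (2 * t).
    apply: (@le_trans _ _ (`|K| * (1 + t))).
      by rewrite ler_wpM2r ?ler_norm //; lra.
    by rewrite ler_wpM2l //; lra.
  apply: (le_trans K1).
  apply: (@le_trans _ _ (eps * ((c * t) ^+ 2 / 2))); last first.
    rewrite ler_wpM2l ?(ltW e0) //; apply: le_trans h.
    by rewrite lerDr.
  have -> : `|K| * (2 * t) = (4 * `|K|) * (t / 2) by field.
  have -> : eps * ((c * t) ^+ 2 / 2) = (t * (c ^+ 2 * eps)) * (t / 2) by field.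
  by rewrite ler_wpM2r // divr_ge0 // ltW.
split.
  apply/cvgrPdist_le => e e0; have := main e e0; apply: filterS => t.
  by apply: le_trans; rewrite distrC -complex_ReB; exact: normRe_le.
apply/cvgrPdist_le => e e0; have := main e e0; apply: filterS => t.
by apply: le_trans; rewrite distrC -complex_ImB; exact: normIm_le.
Unshelve. all: by end_near. Qed.

End Decomposition.

(** * Growth of the transient and conclusion *)

Section Asymptotics.
Variable R : realType.
Implicit Types (g : R -> R -> R[i]) (xi v t : R).

Lemma Lambda1_gt0 xi : `|xi| < Num.sqrt pi -> 0 < 1 + Lambda xi.
Proof.
move=> xipi; rewrite /Lambda; case: eqVneq => [_|xi0]; first by rewrite addr0.
by rewrite addrA subrr add0r xi_eta_gt0.
Qed.

Definition transient g t xi v : R[i] :=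
  - pv_integral v (fun w =>
      cexp (- 'i%C * (xi * w * t)%:C) * K0 g xi w / ('i%C * (w - v)%:C)) +
  cexp (- 'i%C * (xi * v * t)%:C) / (phi v)%:C *
  (xi%:C - pv_integral v (fun w => (phi w)%:C / ('i%C * (w - v)%:C))) * K0 g xi v.

Lemma transient_bound g xi v : `|xi| < Num.sqrt pi ->
  cintegrable setT (fun v => (phi v)%:C * g xi v) -> holder_continuous (F0 g xi) ->
  exists K : R, forall t, 0 <= t -> normc (transient g t xi v) <= K * (1 + t).
Proof.
move=> xipi ig hF.
have [K HK] : exists K : R, forall t, 0 <= t ->
    normc (pv_integral v (fun w => wave xi t w * K0 g xi w / ('i * (w - v)%:C))) <= K * (1 + t).
  have [xi0|xi0] := eqVneq xi 0; last first.
    by have [bK iK] := K0_regular xi0 xipi ig hF; exact: pv_wave_bound.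
  exists (normc (pv_integral v (fun w => wave xi 0 w * K0 g xi w / ('i * (w - v)%:C)))) => t t0.
  have -> : wave xi t = wave xi 0.
    by apply/funext => w; rewrite /wave xi0 !mul0r.
  by rewrite ler_peMr ?normc_ge0 // lerDl.
pose c : R[i] := ((phi v)%:C)^-1 *
  (xi%:C - pv_integral v (fun w => (phi w)%:C / ('i%C * (w - v)%:C))) * K0 g xi v.
exists (K + normc c) => t t0; rewrite /transient.
apply: (le_trans (normcD_le _ _)); rewrite normc_opp mulrDl.
apply: lerD; first exact: HK.
rewrite -/(wave xi t v) -!mulrA [((phi v)%:C)^-1 * _]mulrA -/c normcM normc_wave mul1r.
by rewrite ler_peMr ?normc_ge0 // lerDl.
Qed.

(** The quotient minus 1 is e^(- (1 + Lambda) t) times the transient times gd_den / C0, and the last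
    factor does not depend on t. *)
Lemma fhat_gd_part_cvg g xi v : `|xi| < Num.sqrt pi -> C0 g xi != 0 ->
  cintegrable setT (fun v => (phi v)%:C * g xi v) -> holder_continuous (F0 g xi) ->
  ccvg +oo (fun t => fhat g t xi v / gd_part g t xi v) 1.
Proof.
move=> xipi C0n ig hF; have [K HK] := transient_bound v xipi ig hF.
have gdn := gd_den_neq0 v xipi.
pose k := gd_den xi v / C0 g xi.
apply: (@linear_exp_cvg0 _ (K * normc k) _ _ (Lambda1_gt0 xipi)) => t t0.
have En : (expR (Lambda xi * t))%:C != 0 :> R[i].
  by rewrite fmorph_eq0 gt_eqF // expR_gt0.
have e : fhat g t xi v / gd_part g t xi v - 1 =
    (expR (- ((1 + Lambda xi) * t)))%:C * (transient g t xi v * k).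
  have -> : (expR (- ((1 + Lambda xi) * t)))%:C =
      (expR (- t))%:C / (expR (Lambda xi * t))%:C :> R[i].
    by rewrite -fmorphV -rmorphM -expRN -expRD; congr (expR _)%:C; ring.
  rewrite /fhat -/(transient g t xi v) /gd_part /k.
  move: (transient g t xi v) (expR (- t))%:C (expR (Lambda xi * t))%:C En => T p q qn.
  move: (C0 g xi) (gd_den xi v) C0n gdn => a b an bn.
  by field; rewrite qn an bn.
rewrite e normcM normcR (gtr0_norm (expR_gt0 _)) ler_wpM2l ?expR_ge0 // normcM.
by rewrite [leRHS]mulrAC; apply: ler_wpM2r; [exact: normc_ge0|exact: HK].
Qed.

Lemma gd_part_grossly_determined g :
  grossly_determined_hat (gd_part g) (C0 g).
Proof.
move=> xi xipi; split => //.
rewrite -[RHS](gd_density (C0 g xi) xipi); congr cintegral; apply/funext => v.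
by rewrite /gd_part mulr0 expR0 mul1r.
Qed.

End Asymptotics.

Unset Implicit Arguments.

Theorem mainTheorem2 (R : realType) (f0 : R -> R -> R)
    (f0_integrable_x : forall v : R,
      (@lebesgue_measure R).-integrable setT (EFin \o (fun x => f0 x v)))
    (f0_density : forall xi : R,
      cintegrable setT (fun v => (phi v)%:C * fourier_x f0 xi v))
    (f0_support : exists2 K : set R,
      compact K /\ K `<=` [set xi | - Num.sqrt pi < xi < Num.sqrt pi] &
      forall xi v : R, ~ K xi -> fourier_x f0 xi v = 0)
    (F0_holder : forall xi : R, holder_continuous (F0 (fourier_x f0) xi)) :
  (forall xi v : R, `|xi| < Num.sqrt pi -> C0 (fourier_x f0) xi != 0 ->
    ccvg +oo (fun t =>
      fhat (fourier_x f0) t xi v / gd_part (fourier_x f0) t xi v) 1) /\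
  grossly_determined_hat (gd_part (fourier_x f0)) (C0 (fourier_x f0)).
Proof.
split; last exact: gd_part_grossly_determined.
by move=> xi v xipi C0n; apply: fhat_gd_part_cvg.
Qed.
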